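(* Let $n\ge 2$ and $c>0$. Among all pairs of vectors $v_1,v_2\in\mathbb R^n$ with $|v_1|^2+|v_2|^2=c^2$, the maximum of $P(v_1,-v_1,v_2,-v_2)$ is attained when $v_1$ and $v_2$ have equal lengths and are orthogonal to each other. That is, if $|v_1|^2+|v_2|^2=|w_1|^2+|w_2|^2=c^2$, $|w_1|=|w_2|$ and $w_1\cdot w_2=0$, then $$P(v_1,-v_1,v_2,-v_2)\le P(w_1,-w_1,w_2,-w_2).$$
   Context: For vectors $u_1,\ldots,u_M\in\mathbb R^n$ put $$P(u_1,\ldots,u_M)=\int_{\mathbb R^n}\max_{1\le i\le M} e^{-|x-u_i|^2}\,dx,$$ where $|\cdot|$ is the Euclidean norm. *)

(* Defs.v *)
From HB Require Import structures.
From mathcomp Require Import all_boot all_order all_algebra.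
From mathcomp Require Import all_classical all_reals all_analysis.

Set Implicit Arguments.
Unset Strict Implicit.
Unset Printing Implicit Defensive.

Import Order.TTheory GRing.Theory Num.Theory.
Import numFieldNormedType.Exports.

Local Open Scope classical_set_scope.
Local Open Scope ring_scope.

(* The product sigma-algebra on R^n = 'rV[R]_n, generated by the coordinates
   (it is the Borel sigma-algebra). *)
Definition rV_display : measure_display.
Proof. exact: default_measure_display. Qed.

Section measurable_rV.
Variables (R : realType) (n : nat).

Let coors : 'I_n -> 'rV[R]_n -> measurableTypeR R := fun i x => x 0 i.

Let rV_set0 : g_sigma_preimage coors set0.
Proof. exact: sigma_algebra0. Qed.

Let rV_setC A : g_sigma_preimage coors A -> g_sigma_preimage coors (~` A).
Proof. exact: sigma_algebraC. Qed.

Let rV_bigcup (F : _^nat) : (forall i, g_sigma_preimage coors (F i)) ->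
  g_sigma_preimage coors (\bigcup_i (F i)).
Proof. exact: sigma_algebra_bigcup. Qed.

HB.instance Definition _ := @isMeasurable.Build rV_display
  'rV[R]_n (g_sigma_preimage coors) rV_set0 rV_setC rV_bigcup.

End measurable_rV.

Lemma measurable_coord (R : realType) (n : nat) (i : 'I_n) :
  measurable_fun [set: 'rV[R]_n]
    (fun x : 'rV[R]_n => x 0 i : measurableTypeR R).
Proof.
move=> _ Y mY; rewrite setTI; apply: sub_sigma_algebra => /=.
rewrite -bigcup_seq/=; exists i => /=; first by rewrite mem_index_enum.
by exists Y => //; rewrite setTI.
Qed.

Lemma measurable_fun_coordP d (T : measurableType d) (R : realType) (n : nat)
    (f : T -> 'rV[R]_n) :
  (forall i, measurable_fun [set: T] (fun t => f t 0 i : measurableTypeR R)) ->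
  measurable_fun [set: T] f.
Proof.
move=> mf _ A mA; rewrite setTI.
suff : preimage_set_system [set: T] f measurable `<=` measurable.
  by apply; exists A => //; rewrite setTI.
rewrite [X in preimage_set_system _ _ X](_ : _ =
  g_sigma_preimage (fun (i : 'I_n) (x : 'rV[R]_n) => x 0 i : measurableTypeR R))//.
rewrite -g_sigma_preimage_comp.
apply: smallest_sub; first exact: sigma_algebra_measurable.
case: n f mf A mA => [|n] f mf A mA; first by rewrite big_ord0.
rewrite -bigcup_mkord_ord; apply: bigcup_sub => i Ii.
by move=> B [C mC <-]; exact: mf.
Qed.

(* The sigma-finiteness instance of the library for [m1 \x m2] is shadowed by
   the one for subprobabilities, hence this explicit statement. *)
Lemma product_measure_sigma_finite d1 d2 (T1 : measurableType d1)
    (T2 : measurableType d2) (R : realType)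
    (m1 : {sigma_finite_measure set T1 -> \bar R})
    (m2 : {sigma_finite_measure set T2 -> \bar R}) :
  sigma_finite setT (m1 \x m2)%E.
Proof.
have /sigma_finiteP[F [TF ndF Foo]] := sigma_finiteT m1.
have /sigma_finiteP[G [TG ndG Goo]] := sigma_finiteT m2.
exists (fun k => F k `*` G k).
  rewrite -setXTT TF TG predeqE => -[x y]; split.
    move=> [/= [k _ Fkx] [l _ Gly]]; exists (maxn k l) => //; split.
    - by move: x Fkx; exact/subsetPset/ndF/leq_maxl.
    - by move: y Gly; exact/subsetPset/ndG/leq_maxr.
  by move=> [k _ []/= ? ?]; split; exists k.
move=> k; have [? ?] := Foo k; have [? ?] := Goo k.
split; first exact: measurableX.
by rewrite product_measure1E// lte_mul_pinfty// ge0_fin_numE.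
Qed.

Section rV_cons.
Variables (R : realType) (n : nat).

(* The identification of R x R^n with R^(n+1). *)
Definition rV_cons (p : measurableTypeR R * 'rV[R]_n) : 'rV[R]_n.+1 :=
  row_mx (p.1%:M : 'rV[R]_1) p.2 : 'rV[R]_(1 + n).

Lemma rV_cons0 p : rV_cons p 0 ord0 = p.1.
Proof.
rewrite (_ : (ord0 : 'I_n.+1) = lshift n (ord0 : 'I_1)); last exact/val_inj.
by apply: etrans (row_mxEl (p.1%:M : 'rV[R]_1) p.2 0 0) _;
  rewrite mxE eqxx mulr1n.
Qed.

Lemma rV_consS p (i : 'I_n) : rV_cons p 0 (lift ord0 i) = p.2 0 i.
Proof.
rewrite (_ : lift ord0 i = rshift 1 i); last exact/val_inj.
exact: (row_mxEr (p.1%:M : 'rV[R]_1) p.2).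
Qed.

Lemma rV_cons_can (x : 'rV[R]_n.+1) :
  rV_cons (x 0 ord0, \row_i x 0 (lift ord0 i)) = x.
Proof.
apply/rowP => i; have [j ->|->] := unliftP ord0 i; last exact: rV_cons0.
by rewrite rV_consS mxE.
Qed.

Lemma measurable_rV_cons :
  measurable_fun [set: measurableTypeR R * 'rV[R]_n] rV_cons.
Proof.
apply: measurable_fun_coordP => i; have [j ->|->] := unliftP ord0 i; last first.
  by under eq_fun do rewrite rV_cons0; exact: measurable_fst.
under eq_fun do rewrite rV_consS.
apply: (@measurableT_comp _ _ _ _ _ _
  (fun x : 'rV[R]_n => x 0 j : measurableTypeR R)).
  exact: measurable_coord.
exact: measurable_snd.
Qed.

Lemma measurable_rV_uncons : measurable_fun [set: 'rV[R]_n.+1]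
  (fun x : 'rV[R]_n.+1 =>
    ((x 0 ord0 : measurableTypeR R), (\row_i x 0 (lift ord0 i) : 'rV[R]_n))).
Proof.
apply: measurable_fun_pair; first exact: measurable_coord.
apply: measurable_fun_coordP => i; under eq_fun do rewrite mxE.
exact: measurable_coord.
Qed.

Local Open Scope ereal_scope.

Variable mu : {sigma_finite_measure set 'rV[R]_n -> \bar R}.

Definition lebesgue_cons : set 'rV[R]_n.+1 -> \bar R :=
  pushforward (@lebesgue_measure R \x mu) rV_cons.

Let lebesgue_cons0 : lebesgue_cons set0 = 0.
Proof. by rewrite /lebesgue_cons /pushforward preimage_set0 measure0. Qed.

Let lebesgue_cons_ge0 A : 0 <= lebesgue_cons A.
Proof. by rewrite /lebesgue_cons /pushforward; exact: measure_ge0. Qed.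

Let lebesgue_cons_sigma_additive : semi_sigma_additive lebesgue_cons.
Proof.
have mpre A : measurable A -> measurable (rV_cons @^-1` A).
  by move=> mA; rewrite -[X in measurable X]setTI; exact: measurable_rV_cons.
move=> F mF tF mUF; rewrite /lebesgue_cons /pushforward preimage_bigcup.
apply: measure_semi_sigma_additive.
- by move=> k; exact: mpre.
- apply/trivIsetP => /= i j _ _ ij; rewrite -preimage_setI.
  by move/trivIsetP : tF => /(_ _ _ _ _ ij) ->//; rewrite preimage_set0.
- by rewrite -preimage_bigcup; exact: mpre.
Qed.

HB.instance Definition _ := isMeasure.Build _ _ _
  lebesgue_cons lebesgue_cons0 lebesgue_cons_ge0 lebesgue_cons_sigma_additive.

Let lebesgue_cons_sigma_finite : sigma_finite setT lebesgue_cons.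
Proof.
have [F TF Foo] : sigma_finite setT (@lebesgue_measure R \x mu).
  exact: product_measure_sigma_finite.
pose u (x : 'rV[R]_n.+1) :=
  ((x 0%R ord0 : measurableTypeR R), (\row_i x 0%R (lift ord0 i) : 'rV[R]_n)).
have uK p : u (rV_cons p) = p.
  case: p => a b; rewrite /u rV_cons0; congr pair.
  by apply/rowP => i; rewrite mxE rV_consS.
exists (fun k => u @^-1` F k).
  by rewrite -preimage_bigcup -TF preimage_setT.
move=> k; have [mF Fk] := Foo k; split.
  by rewrite -[X in measurable X]setTI; exact: measurable_rV_uncons.
rewrite /lebesgue_cons /pushforward (_ : _ @^-1` _ = F k)//.
by apply/seteqP; split => p /=; rewrite uK.
Qed.

HB.instance Definition _ := Measure_isSigmaFinite.Build _ _ _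
  lebesgue_cons lebesgue_cons_sigma_finite.

End rV_cons.

(* Lebesgue measure on R^n, as the iterated product of the Lebesgue measure of
   R; on R^0 = {0} it is the unit mass. *)
Fixpoint lebesgue_rV (R : realType) (n : nat) :
    {sigma_finite_measure set 'rV[R]_n -> \bar R} :=
  match n with
  | 0 => dirac (0 : 'rV[R]_0)
  | n'.+1 => lebesgue_cons (lebesgue_rV R n')
  end.

Lemma lebesgue_rV_box (R : realType) (n : nat)
    (A : 'I_n -> set (measurableTypeR R)) :
  (forall i, measurable (A i)) ->
  lebesgue_rV R n [set x | forall i, A i (x 0 i)] =
  (\prod_(i < n) lebesgue_measure (A i))%E.
Proof.
elim: n A => [A _|n IH A mA].
  by rewrite big_ord0 /= diracE mem_set// => -[].
rewrite big_ord_recl -(IH (fun i => A (lift ord0 i)))//.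
rewrite /= /lebesgue_cons /pushforward -product_measure1E//; last first.
  rewrite [X in measurable X](_ : _ = \bigcap_(i : 'I_n)
    ((fun x : 'rV[R]_n => x 0 i : measurableTypeR R) @^-1` A (lift ord0 i))).
    apply: fin_bigcap_measurable => // i _.
    by rewrite -[X in measurable X]setTI; exact: measurable_coord.
  by apply/seteqP; split => x /= h i; [move=> _|]; exact: h.
congr (_ \x _)%E; apply/seteqP; split => -[a b] /=.
  move=> h; split; first by have := h ord0; rewrite rV_cons0.
  by move=> i; have := h (lift ord0 i); rewrite rV_consS.
move=> [h0 h] i; have [j ->|->] := unliftP ord0 i; last by rewrite rV_cons0.
by rewrite rV_consS; exact: h.
Qed.

(* The library norm on 'rV[R]_n is the sup norm. *)
Definition dotr (R : realType) (n : nat) (x y : 'rV[R]_n) : R :=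
  \sum_(i < n) x 0 i * y 0 i.

Definition enorm (R : realType) (n : nat) (x : 'rV[R]_n) : R :=
  Num.sqrt (dotr x x).

(* The base value 0 of the maximum is harmless, the exponentials being
   positive. *)
Definition P (R : realType) (n : nat) (us : seq 'rV[R]_n) : \bar R :=
  (\int[lebesgue_rV R n]_x
     (\big[Num.max/0]_(u <- us) expR (- enorm (x - u) ^+ 2))%:E)%E.

(* Main.v *)
Require Import Defs.
From mathcomp Require Import all_boot all_order all_algebra.
From mathcomp Require Import all_classical all_reals all_analysis.
From mathcomp Require Import measurable_realfun.
From mathcomp Require Import ring lra.
Import Order.TTheory GRing.Theory Num.Theory.
Import numFieldNormedType.Exports.
Local Open Scope classical_set_scope.
Local Open Scope ring_scope.

(* With a = |v1| and b = |v2|, P(v1,-v1,v2,-v2) is the Gaussian integral of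
   max(exp(2|x.v1| - a^2), exp(2|x.v2| - b^2)); by rotation invariance it is a
   planar integral depending only on the Gram matrix of (v1, v2).  For fixed
   lengths, Sidak's inequality for the two families of symmetric strips shows
   that orthogonal vectors are best.  For orthogonal vectors with b <= a, split
   the integral along the Voronoi cells of the rhombus (+-a, 0), (0, +-b): in
   the first quadrant the two cells, recentered at their points, are half-planes
   minus truncated sectors, and the Gaussian mass of a truncated sector is a
   one-dimensional integral over the slopes s of its rays, with density
   k_h(s) = exp(-h^2 (1 + s^2)) / (2 (1 + s^2)), h being the distance to the
   edge.  All sides of the rhombus have length c, so comparison with the square
   amounts to
     2 int_{b/a}^1 k_{c/2} <= int_0^{(a^2 - b^2)/(2ab)} k_b,
   and after the angle-doubling substitution (1/s - s)/2 on the right this holds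
   pointwise. *)

Local Notation "'ind' b" :=
  ((b%R : bool)%:R) (at level 0, b at level 0, only parsing).

(** * Measurability and invariance of Lebesgue measure in the plane *)

Lemma measurable_boolR d (T : measurableType d) (R : realType) (D : set T)
    (b : T -> bool) :
  measurable_fun D b -> measurable_fun D (fun z => (b z)%:R : R).
Proof.
move=> mb; exact: (@measurableT_comp _ _ _ _ _ _ (fun x : bool => x%:R : R)).
Qed.

Lemma measurable_ler_cst (R : realType) (D : set R) (c : R) :
  measurable_fun D (fun x : R => c <= x).
Proof.
by apply: measurable_fun_ler; [exact: measurable_cst|exact: measurable_id].
Qed.

Lemma measurable_ltr_cst (R : realType) (D : set R) (c : R) :
  measurable_fun D (fun x : R => c < x).
Proof.
by apply: measurable_fun_ltr; [exact: measurable_cst|exact: measurable_id].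
Qed.

Lemma measurable_in_itv (R : realType) (i : interval R) :
  measurable_fun [set: R] (fun x : R => x \in i).
Proof.
move=> mT; apply: (measurable_fun_bool true) => //.
rewrite setTI [X in measurable X](_ : _ = [set` i]); first exact: measurable_itv.
by apply/seteqP; split => x /=; case: (x \in i).
Qed.

(** Syntax-directed proof of measurability: it descends through the arithmetic and boolean
    structure, closes opaque functions with hypotheses of the context, and hands back the leaves it
    cannot settle. *)
Ltac meas := lazymatch goal with
  | |- measurable_fun _ (fun z => (@?f z, @?g z)) =>
      apply: measurable_fun_pair; meas
  | |- measurable_fun _ (fun z => @?f z + - @?g z) =>
      apply: measurable_funB; meas
  | |- measurable_fun _ (fun z => @?f z + @?g z) =>
      apply: measurable_funD; meas
  | |- measurable_fun _ (fun z => @?f z * @?g z) =>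
      apply: measurable_funM; meas
  | |- measurable_fun _ (fun z => - @?f z) => apply: measurable_funN; meas
  | |- measurable_fun _ (fun z => @?f z ^+ _) => apply: measurable_funX; meas
  | |- measurable_fun _ (fun z => `| @?f z |) =>
      apply: (measurableT_comp (@normr_measurable _ setT)); meas
  | |- measurable_fun _ (fun z => expR (@?f z)) =>
      apply: (measurableT_comp (@measurable_expR _)); meas
  | |- measurable_fun _ (fun z => Num.max (@?f z) (@?g z)) =>
      apply: measurable_maxr; meas
  | |- measurable_fun _ (fun z => @?f z <= @?g z) =>
      apply: measurable_fun_ler; meas
  | |- measurable_fun _ (fun z => @?f z < @?g z) =>
      apply: measurable_fun_ltr; meas
  | |- measurable_fun _ (fun z => (nat_of_bool (@?b z))%:R) =>
      apply: measurable_boolR; meas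
  | |- measurable_fun _ (fun z => @?f z == @?g z) =>
      apply: measurable_fun_eqr; meas
  | |- measurable_fun _ (fun z => ~~ @?b z) => apply: measurable_neg; meas
  | |- measurable_fun _ (fun z => @?f z && @?g z) =>
      apply: measurable_and; meas
  | |- measurable_fun _ (fun z => @?f z || @?g z) =>
      apply: measurable_or; meas
  | |- measurable_fun _ (fun z => (@?f z)%:E) =>
      apply/measurable_EFinP; meas
  | |- measurable_fun _ (fun z => z) => exact: measurable_id
  | |- measurable_fun _ (fun z => fst z) => exact: measurable_fst
  | |- measurable_fun _ (fun z => snd z) => exact: measurable_snd
  | |- measurable_fun _ (fun z => fst (@?f z)) =>
      apply: (measurableT_comp (@measurable_fst _ _ _ _)); meas
  | |- measurable_fun _ (fun z => snd (@?f z)) =>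
      apply: (measurableT_comp (@measurable_snd _ _ _ _)); meas
  | |- measurable_fun _ fst => exact: measurable_fst
  | |- measurable_fun _ snd => exact: measurable_snd
  | H : measurable_fun _ ?f |- measurable_fun _ ?f => exact: H
  | H : measurable_fun _ ?f |- measurable_fun _ (fun z => ?f (@?g z)) =>
      apply: (measurableT_comp H); meas
  | H : measurable_fun _ (fun w => ?f w) |- measurable_fun _ (fun z => ?f (@?g z)) =>
      apply: (measurableT_comp H); meas
  | |- _ => first [exact: measurable_cst
    | exact: measurable_ler_cst | exact: measurable_ltr_cst
    | exact: measurable_in_itv | exact: mulrl_measurable | idtac]
  end.

Section real_integrands.
Context d (T : measurableType d) (R : realType) (m : {measure set T -> \bar R}).
Implicit Types (f h : T -> R) (k : R).

Lemma integralRZl k f : 0 <= k -> measurable_fun setT f -> (forall x, 0 <= f x) ->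
  (\int[m]_x (k * f x)%:E = k%:E * \int[m]_x (f x)%:E)%E.
Proof.
move=> k0 mf f0; under eq_integral do rewrite EFinM.
rewrite (ge0_integralZl_EFin m measurableT _ _ k0)//; last by meas.
by move=> x _; rewrite lee_fin.
Qed.

Lemma integralRD f h : measurable_fun setT f -> measurable_fun setT h ->
  (forall x, 0 <= f x) -> (forall x, 0 <= h x) ->
  (\int[m]_x (f x + h x)%:E = \int[m]_x (f x)%:E + \int[m]_x (h x)%:E)%E.
Proof.
move=> mf mh f0 h0; under eq_integral do rewrite EFinD.
rewrite (ge0_integralD m measurableT)//.
- by move=> x _; rewrite lee_fin.
- by meas.
- by move=> x _; rewrite lee_fin.
- by meas.
Qed.

Lemma le_integralR f h : measurable_fun setT f -> measurable_fun setT h ->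
  (forall x, 0 <= f x) -> (forall x, f x <= h x) ->
  (\int[m]_x (f x)%:E <= \int[m]_x (h x)%:E)%E.
Proof.
move=> mf mh f0 fh; apply: (ge0_le_integral m measurableT).
- by move=> x _; rewrite lee_fin.
- by meas.
- by meas.
- by move=> x _; rewrite lee_fin.
Qed.

End real_integrands.

Section affine.
Context {R : realType}.
Notation mu := (@lebesgue_measure R).

Section positive.
Variables (k t : R) (k0 : 0 < k).

Let phi (x : measurableTypeR R) : measurableTypeR R := k * x + t.

Let mphi : measurable_fun setT phi.
Proof. by rewrite /phi; meas. Qed.

Let nu : {measure set (measurableTypeR R) -> \bar R} :=
  measure_function_pushforward__canonical__measure_function_Measure mu mphi.

Let knn : {nonneg R} := NngNum (ltW k0).

(** Uniqueness of Lebesgue measure: [k] times the image of [mu] under [phi] gives half-open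
    intervals their length. *)
Let lebesgue_measure_affine (A : set (measurableTypeR R)) : measurable A ->
  mu A = mscale knn nu A.
Proof.
apply: lebesgue_measure_unique => X [[a b] /= ab <-].
rewrite /mscale /= /pushforward.
rewrite (_ : phi @^-1` _ = `](a - t) / k, (b - t) / k]%classic); last first.
  apply/seteqP; split => x /=; rewrite !in_itv /= ltr_pdivrMr// ler_pdivlMr//
    /phi ltrBlDr lerBrDr mulrC //.
rewrite !lebesgue_measure_itv/= !lte_fin ltr_pM2r ?invr_gt0// ltrD2r.
case: ifP => _; last by rewrite mule0.
rewrite -!EFinB -EFinM; congr EFin; field; exact: lt0r_neq0.
Qed.

Lemma integral_affine_gt0 (f : R -> \bar R) : measurable_fun setT f ->
  (forall x, 0 <= f x)%E ->
  (\int[mu]_x f x = k%:E * \int[mu]_x f (k * x + t)%R)%E.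
Proof.
move=> mf f0.
rewrite (@eq_measure_integral _ _ _ _ (mscale knn nu)); last first.
  by move=> A mA _; exact: lebesgue_measure_affine.
rewrite ge0_integral_mscale//; congr (_ * _)%E.
by rewrite ge0_integral_pushforward ?preimage_setT.
Qed.

End positive.

Lemma lebesgue_integral_opp (f : R -> \bar R) : measurable_fun setT f ->
  (forall x, 0 <= f x)%E ->
  (\int[mu]_x f (- x)%R = \int[mu]_x f x)%E.
Proof.
move=> mf f0.
transitivity (\int[pushforward mu (-%R : measurableTypeR R -> measurableTypeR R)]_x f x)%E.
  by rewrite ge0_integral_pushforward ?preimage_setT//; exact: oppr_measurable.
by apply: eq_measure_integral => A mA _; exact: lebesgue_measureN.
Qed.

Lemma integral_translation (t : R) (f : R -> \bar R) : measurable_fun setT f ->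
  (forall x, 0 <= f x)%E ->
  (\int[mu]_x f (x + t)%R = \int[mu]_x f x)%E.
Proof.
move=> mf f0; rewrite [RHS](@integral_affine_gt0 1 t)// mul1e.
by apply: eq_integral => x _; rewrite mul1r.
Qed.

End affine.

Section plane.
Context {R : realType}.
Notation T := (measurableTypeR R).
Notation mu := (@lebesgue_measure R).
Notation mu2 := (mu \x mu)%E.
Implicit Types f : T * T -> \bar R.

Lemma integral21 f : measurable_fun setT f -> (forall z, 0 <= f z)%E ->
  (\int[mu2]_z f z = \int[mu]_y \int[mu]_x f (x, y))%E.
Proof. by move=> mf f0; rewrite fubini_tonelli2. Qed.

Lemma integral12 f : measurable_fun setT f -> (forall z, 0 <= f z)%E ->
  (\int[mu2]_z f z = \int[mu]_x \int[mu]_y f (x, y))%E.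
Proof. by move=> mf f0; rewrite fubini_tonelli1. Qed.

(** For a fixed second coordinate the shear is a translation of the first one, so Tonelli
    applies. *)
Lemma integral_shear1 (s t : R) f : measurable_fun setT f ->
  (forall z, 0 <= f z)%E ->
  (\int[mu2]_z f (z.1 + s * z.2 + t, z.2)%R = \int[mu2]_z f z)%E.
Proof.
move=> mf f0.
have mg : measurable_fun [set: T * T] (fun z : T * T => f (z.1 + s * z.2 + t, z.2)%R).
  by meas.
rewrite (integral21 _ mg); last by move=> z; exact: f0.
rewrite (integral21 _ mf f0); apply: eq_integral => y _.
under eq_integral do rewrite -addrA.
apply: (@integral_translation _ (s * y + t) (fun x => f (x, y))) => //.
exact: measurable_fun_pair1.
Qed.

Lemma integral_shear2 (s t : R) f : measurable_fun setT f ->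
  (forall z, 0 <= f z)%E ->
  (\int[mu2]_z f (z.1, z.2 + s * z.1 + t)%R = \int[mu2]_z f z)%E.
Proof.
move=> mf f0.
have mg : measurable_fun [set: T * T] (fun z : T * T => f (z.1, z.2 + s * z.1 + t)%R).
  by meas.
rewrite (integral12 _ mg); last by move=> z; exact: f0.
rewrite (integral12 _ mf f0); apply: eq_integral => x _.
under eq_integral do rewrite -addrA.
apply: (@integral_translation _ (s * x + t) (fun y => f (x, y))) => //.
exact: measurable_fun_pair2.
Qed.

Lemma integral_opp2 f : measurable_fun setT f -> (forall z, 0 <= f z)%E ->
  (\int[mu2]_z f (z.1, - z.2)%R = \int[mu2]_z f z)%E.
Proof.
move=> mf f0.
have mg : measurable_fun [set: T * T] (fun z : T * T => f (z.1, - z.2)%R).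
  by meas.
rewrite (integral12 _ mg); last by move=> z; exact: f0.
rewrite (integral12 _ mf f0); apply: eq_integral => x _.
apply: (@lebesgue_integral_opp _ (fun y => f (x, y))) => //.
exact: measurable_fun_pair2.
Qed.

Lemma integral_swap f : measurable_fun setT f -> (forall z, 0 <= f z)%E ->
  (\int[mu2]_z f (z.2, z.1) = \int[mu2]_z f z)%E.
Proof.
move=> mf f0.
rewrite integral21//; first by rewrite [RHS]integral12.
by meas.
Qed.

Lemma integral_opp1 f : measurable_fun setT f -> (forall z, 0 <= f z)%E ->
  (\int[mu2]_z f (- z.1, z.2)%R = \int[mu2]_z f z)%E.
Proof.
move=> mf f0.
have mg : measurable_fun [set: T * T] (fun z : T * T => f (- z.1, z.2)%R).
  by meas.
rewrite (integral21 _ mg); last by move=> z; exact: f0.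
rewrite (integral21 _ mf f0); apply: eq_integral => y _.
apply: (@lebesgue_integral_opp _ (fun x => f (x, y))) => //.
exact: measurable_fun_pair1.
Qed.

(* A rotation of angle not a multiple of pi is a product of three shears. *)
Lemma integral_rotation (c s : R) f : c ^+ 2 + s ^+ 2 = 1 ->
  measurable_fun setT f -> (forall z, 0 <= f z)%E ->
  (\int[mu2]_z f (c * z.1 - s * z.2, s * z.1 + c * z.2)%R = \int[mu2]_z f z)%E.
Proof.
move=> cs mf f0; have [s0|s0] := eqVneq s 0.
  rewrite s0 expr0n addr0 in cs.
  have /orP[/eqP ->|/eqP ->] : (c == 1) || (c == -1) by rewrite -sqrf_eq1 cs.
    by apply: eq_integral => -[x y] _ /=; rewrite s0 !mul1r !mul0r subr0 add0r.
  rewrite -[RHS]integral_opp1// -[RHS]integral_opp2//; last first.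
    by meas.
  by apply: eq_integral => -[x y] _ /=; rewrite s0 !mulN1r !mul0r subr0 add0r.
(* With c = cos x and s = sin x this is -tan(x/2); the shears of slopes [t], [s], [t] compose to the
   rotation. *)
pose t := (c - 1) / s.
rewrite -[RHS](@integral_shear1 t 0)//.
rewrite -[RHS](@integral_shear2 s 0)//; last first.
  by meas.
rewrite -[RHS](@integral_shear1 t 0)//; last first.
  by meas.
have ts : t * s = c - 1 by rewrite /t mulfVK.
have tc : t * (1 + c) = - s.
  apply: (mulIf s0); rewrite mulrAC ts mulNr -expr2.
  by rewrite -[s ^+ 2](addKr (c ^+ 2)) cs; ring.
apply: eq_integral => -[x y] _ /=; congr (f (_, _)); apply/eqP; rewrite -subr_eq0.
  rewrite [X in X == 0](_ : _ = (c - 1 - t * s) * (x + t * y)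
    - (s + t * (1 + c)) * y); last by ring.
  by rewrite ts tc !subrr !mul0r subrr.
rewrite [X in X == 0](_ : _ = (c - 1 - t * s) * y); last by ring.
by rewrite ts subrr mul0r.
Qed.

End plane.

(** * Reduction to the plane *)

Section gauss.
Context {R : realType}.
Notation T := (measurableTypeR R).
Notation mu := (@lebesgue_measure R).
Notation mu2 := (mu \x mu)%E.
Notation g := (Num.sqrt (@pi R)).

Lemma sqrt_pi_gt0 : 0 < g. Proof. by rewrite sqrtr_gt0 pi_gt0. Qed.

Lemma integral2M (a b : R -> R) : measurable_fun setT a -> measurable_fun setT b ->
  (forall x, 0 <= a x) -> (forall x, 0 <= b x) ->
  (\int[mu2]_z (a z.1 * b z.2)%:E =
   (\int[mu]_x (a x)%:E) * (\int[mu]_x (b x)%:E))%E.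
Proof.
move=> ma mb a0 b0; rewrite integral12; last 2 first.
- by meas.
- by move=> z; rewrite lee_fin mulr_ge0.
under eq_integral => x _ /=.
  under eq_integral do rewrite EFinM.
  rewrite ge0_integralZl_EFin//; last 2 first.
  - by move=> *; rewrite lee_fin.
  - by meas.
  over.
rewrite ge0_integralZr//.
- by meas.
- by move=> *; rewrite lee_fin.
- by apply: integral_ge0 => *; rewrite lee_fin.
Qed.

(** Kept as an iterated integral, so that a rotation of two of the three coordinates reduces to the
    planar case. *)
Definition integral3 (K : T * T * T -> \bar R) :=
  (\int[mu]_a \int[mu]_b \int[mu]_c K (a, b, c))%E.

Lemma measurable_integral3 K : measurable_fun setT K -> (forall z, 0 <= K z)%E ->
  measurable_fun [set: T * T] (fun z => \int[mu]_c K (z.1, z.2, c))%E.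
Proof.
move=> mK K0.
have -> : (fun z : T * T => \int[mu]_c K (z.1, z.2, c))%E = fubini_F mu K.
  by apply/funext => -[].
exact: measurable_fun_fubini_tonelli_F.
Qed.

Lemma integral3E K : measurable_fun setT K -> (forall z, 0 <= K z)%E ->
  integral3 K = (\int[mu2]_z \int[mu]_c K (z.1, z.2, c))%E.
Proof.
move=> mK K0; rewrite /integral3 integral12//.
- exact: measurable_integral3.
- by move=> z; exact: integral_ge0.
Qed.

Lemma integral3_rotation12 (c s : R) K : c ^+ 2 + s ^+ 2 = 1 ->
  measurable_fun setT K -> (forall z, 0 <= K z)%E ->
  integral3 (fun z => K (c * z.1.1 - s * z.1.2, s * z.1.1 + c * z.1.2, z.2)) =
  integral3 K.
Proof.
move=> cs mK K0; rewrite integral3E; last 2 first.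
- by meas.
- by move=> z; exact: K0.
rewrite (integral3E _ mK K0) /= -(integral_rotation c s (fun z => \int[mu]_c K (z.1, z.2, c))%E cs).
- by [].
- exact: measurable_integral3.
- by move=> z; exact: integral_ge0.
Qed.

Lemma integral3_swap23 K : measurable_fun setT K -> (forall z, 0 <= K z)%E ->
  integral3 (fun z => K (z.1.1, z.2, z.1.2)) = integral3 K.
Proof.
move=> mK K0; apply: eq_integral => a _ /=.
have mKa : measurable_fun setT (fun z : T * T => K (a, z.1, z.2)) by meas.
rewrite -(integral12 (fun z => K (a, z.1, z.2)))//.
by rewrite (integral21 (fun z => K (a, z.1, z.2))).
Qed.

(** Conjugation of the rotation in the first two coordinates by the exchange of the last two. *)
Lemma integral3_rotation13 (c s : R) K : c ^+ 2 + s ^+ 2 = 1 ->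
  measurable_fun setT K -> (forall z, 0 <= K z)%E ->
  integral3 (fun z => K (c * z.1.1 - s * z.2, z.1.2, s * z.1.1 + c * z.2)) =
  integral3 K.
Proof.
move=> cs mK K0; rewrite -[RHS](integral3_swap23 _ mK K0).
rewrite -[RHS](integral3_rotation12 _ _ _ cs); last 2 first.
- by meas.
- by move=> z; exact: K0.
rewrite -[RHS]integral3_swap23; last 2 first.
- by meas.
- by move=> z; exact: K0.
by [].
Qed.

Lemma polar_coordinates (p q : R) : exists r c s, [/\ c ^+ 2 + s ^+ 2 = 1,
  p = r * c & q = r * s].
Proof.
have [/eqP pq0|pq0] := eqVneq (p ^+ 2 + q ^+ 2) 0.
  move: pq0; rewrite paddr_eq0 ?sqr_ge0// !sqrf_eq0 => /andP[/eqP -> /eqP ->].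
  by exists 0, 1, 0; rewrite !mul0r expr1n expr0n addr0.
have pq : 0 <= p ^+ 2 + q ^+ 2 by rewrite addr_ge0 ?sqr_ge0.
have r0 : Num.sqrt (p ^+ 2 + q ^+ 2) != 0 by rewrite sqrtr_eq0 -ltNge lt0r pq0.
exists (Num.sqrt (p ^+ 2 + q ^+ 2)), (p / Num.sqrt (p ^+ 2 + q ^+ 2)),
  (q / Num.sqrt (p ^+ 2 + q ^+ 2)); split.
- by rewrite !exprMn -mulrDl exprVn sqr_sqrtr// mulfV.
- by rewrite mulrC mulfVK.
- by rewrite mulrC mulfVK.
Qed.

(** The rows ([al], 0) and ([be], [ga]) form a triangular factor of a Gram matrix with entries al^2,
    al be and be^2 + ga^2. *)
Definition gauss_planar (Psi : R * R -> R) (al be ga : R) : \bar R :=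
  (\int[mu2]_z (expR (- z.1 ^+ 2 - z.2 ^+ 2) *
    Psi (al * z.1, be * z.1 + ga * z.2)%R)%:E)%E.

(** Adding a coordinate [t] turns the two linear forms into vectors of R^3. Two rotations, which
    preserve the Gaussian weight, make these triangular again; the coordinate left over integrates
    to sqrt(pi). *)
Lemma gauss_planar_step (al be ga p q : R) : exists al' be' ga' : R,
  [/\ al' ^+ 2 = al ^+ 2 + p ^+ 2, al' * be' = al * be + p * q,
      be' ^+ 2 + ga' ^+ 2 = be ^+ 2 + ga ^+ 2 + q ^+ 2
   & forall Psi : R * R -> R, measurable_fun setT Psi -> (forall z, 0 <= Psi z) ->
     (\int[mu]_t ((expR (- t ^+ 2))%:E *
        gauss_planar (fun z => Psi (z.1 + t * p, z.2 + t * q)%R) al be ga) =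
      g%:E * gauss_planar Psi al' be' ga')%E].
Proof.
(* A rotation in (t, x) clears [p] from the first form and leaves be' x + ga y + de t as the second;
   a rotation in (t, y) then clears [de]. *)
have [al' [c [s [cs alE pE]]]] := polar_coordinates al p.
pose be' := be * c + q * s; pose de := q * c - be * s.
have [ga' [c' [s' [cs' gaE deE]]]] := polar_coordinates ga de.
exists al', be', ga'; split.
- by rewrite alE pE !exprMn -mulrDr cs mulr1.
- by rewrite alE pE /be'; ring.
- have -> : ga' ^+ 2 = ga ^+ 2 + de ^+ 2.
    by rewrite gaE deE !exprMn -mulrDr cs' mulr1.
  rewrite /be' /de.
  transitivity (ga ^+ 2 + (be ^+ 2 + q ^+ 2) * (c ^+ 2 + s ^+ 2)); first by ring.
  by rewrite cs; ring.
move=> Psi mPsi Psi0.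
pose K (z : T * T * T) : \bar R := (expR (- z.1.1 ^+ 2 - z.1.2 ^+ 2 - z.2 ^+ 2) *
  Psi (al * z.1.2 + z.1.1 * p, be * z.1.2 + ga * z.2 + z.1.1 * q))%:E.
have mK : measurable_fun setT K by rewrite /K; meas.
have K0 z : (0 <= K z)%E by rewrite /K lee_fin mulr_ge0 ?expR_ge0.
transitivity (integral3 K).
  apply: eq_integral => t _ /=.
  rewrite /gauss_planar -ge0_integralZl_EFin//; last 2 first.
  - by move=> *; rewrite lee_fin mulr_ge0// expR_ge0.
  - by meas.
  rewrite integral12; last 2 first.
  - by apply: measurable_funeM; meas.
  - by move=> z; rewrite -EFinM lee_fin mulr_ge0 ?mulr_ge0// expR_ge0.
  apply: eq_integral => x _; apply: eq_integral => y _ /=.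
  rewrite /K -EFinM mulrA -expRD /=; congr (expR _ * _)%:E; exact: addrA.
rewrite -(integral3_rotation12 c (- s) K _ mK K0); last by rewrite sqrrN.
rewrite -(integral3_rotation13 c' (- s')); last 3 first.
- by rewrite sqrrN.
- by meas.
- by move=> z; exact: K0.
transitivity (integral3 (fun z => (expR (- z.1.1 ^+ 2) * (expR (- z.1.2 ^+ 2 - z.2 ^+ 2) *
   Psi (al' * z.1.2, be' * z.1.2 + ga' * z.2)))%:E)).
  apply: eq_integral => t _; apply: eq_integral => x _; apply: eq_integral => y _.
  rewrite /K /= mulrA -expRD; congr EFin; congr (expR _ * Psi (_, _)).
  - have e (a b a' b' : R) : a ^+ 2 + b ^+ 2 = 1 ->
        (a * a' - - b * b') ^+ 2 + (- b * a' + a * b') ^+ 2 = a' ^+ 2 + b' ^+ 2.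
      by move=> ab; rewrite -[RHS]mul1r -ab; ring.
    rewrite -opprD (e c s _ _ cs).
    transitivity (- x ^+ 2 - ((c' * t - - s' * y) ^+ 2 + (- s' * t + c' * y) ^+ 2)).
      by ring.
    by rewrite (e c' s' _ _ cs'); ring.
  - by rewrite alE pE -[al' * x]mul1r -cs; ring.
  - have -> : q = be' * s + de * c.
      by rewrite /be' /de -[LHS]mulr1 -cs; ring.
    have -> : be = be' * c - de * s.
      by rewrite /be' /de -[LHS]mulr1 -cs; ring.
    rewrite deE gaE.
    transitivity ((c ^+ 2 + s ^+ 2) * be' * x +
      (c ^+ 2 + s ^+ 2) * ga' * s' * (c' * t - - s' * y) +
      ga' * c' * (- s' * t + c' * y)); first by ring.
    rewrite cs mul1r; transitivity (be' * x + ga' * y * (c' ^+ 2 + s' ^+ 2)).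
      by ring.
    by rewrite cs' mulr1.
transitivity (\int[mu]_t ((expR (- t ^+ 2))%:E * gauss_planar Psi al' be' ga'))%E.
  apply: eq_integral => t _.
  rewrite /gauss_planar -ge0_integralZl_EFin//; last 2 first.
  - by move=> *; rewrite lee_fin mulr_ge0// expR_ge0.
  - by meas.
  rewrite [RHS]integral12; last 2 first.
  - by apply: measurable_funeM; meas.
  - by move=> z; rewrite -EFinM lee_fin mulr_ge0 ?mulr_ge0// expR_ge0.
  by [].
(* The variable [t] now occurs in the Gaussian factor only. *)
rewrite ge0_integralZr//.
- by congr (_ * _)%E; exact: integralT_gauss.
- by meas.
- by apply: integral_ge0 => z _; rewrite lee_fin mulr_ge0// expR_ge0.
Qed.

Lemma measurable_dotr n (v : 'rV[R]_n) :
  measurable_fun setT (fun x : 'rV[R]_n => dotr x v).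
Proof.
apply: measurable_sum => i.
by apply: measurable_funM; [exact: measurable_coord|exact: measurable_cst].
Qed.

Lemma measurable_dotr2 n :
  measurable_fun setT (fun x : 'rV[R]_n => dotr x x).
Proof.
apply: measurable_sum => i.
by apply: measurable_funM; exact: measurable_coord.
Qed.

Lemma dotr_cons n (a b : R) (u v : 'rV[R]_n) :
  dotr (rV_cons (a, u)) (rV_cons (b, v)) = a * b + dotr u v.
Proof.
rewrite /dotr big_ord_recl !rV_cons0; congr (_ + _).
by apply: eq_bigr => i _; rewrite !rV_consS.
Qed.

(** The measure on R^(n+1) is by construction an image of a product measure, so this is a change of
    variables followed by Tonelli. *)
Lemma integral_lebesgue_rVS n (f : 'rV[R]_n.+1 -> \bar R) :
  measurable_fun setT f -> (forall x, 0 <= f x)%E ->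
  (\int[lebesgue_rV R n.+1]_x f x =
   \int[mu]_t \int[lebesgue_rV R n]_x f (rV_cons (t, x)))%E.
Proof.
move=> mf f0.
transitivity (\int[pushforward (mu \x lebesgue_rV R n) (@rV_cons R n)]_x f x)%E.
  by [].
rewrite ge0_integral_pushforward//; last exact: measurable_rV_cons.
rewrite preimage_setT fubini_tonelli1//; last by move=> z; exact: f0.
by apply: (measurableT_comp mf); exact: measurable_rV_cons.
Qed.

(** Induction on [n], one coordinate at a time. The constants balance the Gaussian masses [g ^+ n]
    of R^n and [g ^+ 2] of the plane; placing them on opposite sides also covers n < 2. *)
Lemma gauss_reduction n (v1 v2 : 'rV[R]_n) : exists al be ga : R,
  [/\ al ^+ 2 = dotr v1 v1, al * be = dotr v1 v2,
      be ^+ 2 + ga ^+ 2 = dotr v2 v2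
   & forall Psi : R * R -> R, measurable_fun setT Psi -> (forall z, 0 <= Psi z) ->
     ((g ^+ 2)%:E * \int[lebesgue_rV R n]_x
        (expR (- dotr x x) * Psi (dotr x v1, dotr x v2)%R)%:E =
      (g ^+ n)%:E * gauss_planar Psi al be ga)%E].
Proof.
elim: n v1 v2 => [|n IH] v1 v2.
  exists 0, 0, 0; rewrite /dotr !big_ord0 expr0n /= mul0r addr0; split => //.
  move=> Psi mPsi Psi0; rewrite mul1e.
  rewrite /= integral_dirac//; last first.
    by meas; [exact: measurable_dotr2|exact: measurable_dotr|exact: measurable_dotr].
  rewrite diracE mem_set// !mul1e /dotr !big_ord0 oppr0 expR0 mul1r.
  rewrite /gauss_planar; under eq_integral do rewrite !mul0r addr0 expRD mulrAC.
  rewrite (integral2M (fun x => expR (- x ^+ 2) * Psi (0, 0))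
    (fun y => expR (- y ^+ 2))).
  - under eq_integral do rewrite EFinM.
    rewrite ge0_integralZr//; last 2 first.
    + by meas.
    + by rewrite lee_fin.
    by rewrite integralT_gauss expr2 !EFinM muleAC.
  - by meas.
  - by meas.
  - by move=> x; rewrite mulr_ge0// expR_ge0.
  - by move=> x; rewrite expR_ge0.
rewrite -(rV_cons_can v1) -(rV_cons_can v2).
move: (v1 0 ord0) (v2 0 ord0) (\row_i v1 0 (lift ord0 i))
  (\row_i v2 0 (lift ord0 i)) => p q u1 u2.
have [al [be [ga [alE beE gaE IHP]]]] := IH u1 u2.
have [al' [be' [ga' [alE' beE' gaE' step]]]] := gauss_planar_step al be ga p q.
exists al', be', ga'; rewrite !dotr_cons; split.
- by rewrite alE' alE; ring.
- by rewrite beE' beE; ring.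
- by rewrite gaE' gaE; ring.
move=> Psi mPsi Psi0; rewrite [g ^+ n.+1]exprSr [(g ^+ n * g)%:E]EFinM -[RHS]muleA -step//.
have mP m (v w : 'rV[R]_m) Phi : measurable_fun setT Phi ->
    measurable_fun setT (fun x : 'rV[R]_m =>
      (expR (- dotr x x) * Phi (dotr x v, dotr x w))%:E).
  by move=> mPhi; meas; [exact: measurable_dotr2|exact: measurable_dotr|
    exact: measurable_dotr].
have P0 m (v w : 'rV[R]_m) Phi x : (forall z, 0 <= Phi z) ->
    (0 <= (expR (- dotr x x) * Phi (dotr x v, dotr x w))%:E)%E.
  by move=> Phi0; rewrite lee_fin mulr_ge0// expR_ge0.
rewrite integral_lebesgue_rVS; last 2 first.
- exact: mP.
- by move=> x; exact: P0.
pose f x := (expR (- dotr x x) *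
  Psi (dotr x (rV_cons (p, u1)), dotr x (rV_cons (q, u2))))%:E.
have mF : measurable_fun setT (fun t : measurableTypeR R =>
    \int[lebesgue_rV R n]_x f (rV_cons (t, x)))%E.
  apply: (measurable_fun_fubini_tonelli_F (f \o @rV_cons R n)).
    by apply: (measurableT_comp (mP _ _ _ _ mPsi)); exact: measurable_rV_cons.
  by move=> z; exact: P0.
have F0 t : (0 <= \int[lebesgue_rV R n]_x f (rV_cons (t, x)))%E.
  by apply: integral_ge0 => x _; exact: P0.
have gn0 : g ^+ n != 0 by rewrite expf_neq0// gt_eqF// sqrt_pi_gt0.
(* The constant [g ^+ 2] is brought inside the integral over [t], where the induction hypothesis
   needs it. *)
transitivity ((g ^+ n)%:E * \int[mu]_t ((g ^+ 2 / g ^+ n)%:E *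
  \int[lebesgue_rV R n]_x f (rV_cons (t, x))))%E.
  rewrite ge0_integralZl_EFin//.
  by rewrite muleA -EFinM mulrC divfK.
congr (_ * _)%E; apply: eq_integral => t _.
set Jt := gauss_planar _ _ _ _.
rewrite (_ : (_ * Jt)%E = ((g ^+ n)^-1%:E * ((expR (- t ^+ 2))%:E *
  ((g ^+ n)%:E * Jt)))%E); last first.
  by rewrite [in RHS]muleCA; congr (_ * _)%E; rewrite muleA -EFinM mulVf// mul1e.
rewrite -IHP//.
- rewrite mulrC EFinM -muleA; congr (_ * _)%E.
  rewrite muleCA; congr (_ * _)%E.
  rewrite -ge0_integralZl_EFin//; last 2 first.
  + by move=> x _; exact: (P0 _ _ _ (fun z => Psi (z.1 + t * p, z.2 + t * q))).
  + apply: (mP n u1 u2 (fun z : T * T => Psi (z.1 + t * p, z.2 + t * q))).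
    by meas.
  apply: eq_integral => x _.
  rewrite /f !dotr_cons -EFinM mulrA -expRD /=.
  by congr (expR _ * Psi (_, _))%:E; ring.
- by meas.
Qed.

End gauss.

(** * Sidak's inequality *)

Section sidak.
Context {R : realType}.
Notation T := (measurableTypeR R).
Notation mu := (@lebesgue_measure R).
Notation mu2 := (mu \x mu)%E.
Notation g := (Num.sqrt (@pi R)).

(** Equal absolute values give both inequalities, so evenness is included. *)
Definition even_mono (h : R -> R) := forall x y, `|x| <= `|y| -> h x <= h y.

(** Since max(u, v) = v + max(u - v, 0), the gain from raising [u'] to [u] shrinks as the second
    argument grows. *)
Lemma max_submodular (u u' v v' : R) : u' <= u -> v' <= v ->
  Num.max u v + Num.max u' v' <= Num.max u v' + Num.max u' v.
Proof. by move=> uu vv; rewrite /Num.max; do ! case: ifP; lra. Qed.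

Lemma expR_le_sqr (a b : R) : a ^+ 2 <= b ^+ 2 ->
  expR (- b ^+ 2) <= expR (- a ^+ 2).
Proof. by move=> ab; rewrite ler_expR lerN2. Qed.

(** The reflection z -> m + m' - z exchanges the two Gaussian weights. After symmetrization under it
    the inequality holds pointwise, by submodularity of the maximum. *)
Lemma shifted_rearrangement (h : R -> R) (u u' ga m m' : R) :
  measurable_fun setT h -> (forall x, 0 <= h x) -> even_mono h ->
  u' <= u -> 0 <= u' -> m' ^+ 2 <= m ^+ 2 ->
  (\int[mu]_z (expR (- (z - m) ^+ 2) * Num.max u (h (ga * z)) +
     expR (- (z - m') ^+ 2) * Num.max u' (h (ga * z)))%:E <=
   \int[mu]_z (expR (- (z - m') ^+ 2) * Num.max u (h (ga * z)) +
     expR (- (z - m) ^+ 2) * Num.max u' (h (ga * z)))%:E)%E.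
Proof.
move=> mh h0 hm uu u0 mm.
pose A z := expR (- (z - m) ^+ 2) * Num.max u (h (ga * z)) +
     expR (- (z - m') ^+ 2) * Num.max u' (h (ga * z)).
pose B z := expR (- (z - m') ^+ 2) * Num.max u (h (ga * z)) +
     expR (- (z - m) ^+ 2) * Num.max u' (h (ga * z)).
have A0 z : 0 <= A z.
  by rewrite addr_ge0// mulr_ge0 ?expR_ge0// le_max h0 orbT.
have B0 z : 0 <= B z.
  by rewrite addr_ge0// mulr_ge0 ?expR_ge0// le_max h0 orbT.
have mA : measurable_fun [set: T] A by rewrite /A; meas.
have mB : measurable_fun [set: T] B by rewrite /B; meas.
have dbl (C : R -> R) : measurable_fun [set: T] C -> (forall z, 0 <= C z) ->
    (2%:E * \int[mu]_z (C z)%:E = \int[mu]_z (C z + C (m + m' - z))%:E)%E.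
  move=> mC C0; under [RHS]eq_integral do rewrite EFinD.
  rewrite ge0_integralD//; last 4 first.
  - by move=> *; rewrite lee_fin.
  - by meas.
  - by move=> *; rewrite lee_fin.
  - by meas.
  rewrite mule_natl mule2n; congr (_ + _)%E.
  rewrite -(lebesgue_integral_opp (fun z => (C (m + m' - z))%:E)); last 2 first.
  - by meas.
  - by move=> *; rewrite lee_fin.
  under [RHS]eq_integral do rewrite opprK addrC.
  by rewrite (integral_translation (m + m') (fun z => (C z)%:E))//; meas.
suff : (2%:E * \int[mu]_z (A z)%:E <= 2%:E * \int[mu]_z (B z)%:E)%E.
  by rewrite lee_pmul2l.
rewrite (dbl _ mA A0) (dbl _ mB B0); apply: ge0_le_integral; [exact: measurableT|..].
- by move=> z _; rewrite lee_fin addr_ge0.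
- by meas.
- by meas.
move=> z _; rewrite lee_fin /A /B.
have -> : (m + m' - z - m) ^+ 2 = (z - m') ^+ 2 by ring.
have -> : (m + m' - z - m') ^+ 2 = (z - m) ^+ 2 by ring.
set e := expR (- (z - m) ^+ 2); set e' := expR (- (z - m') ^+ 2).
set w := m + m' - z.
pose br := Num.max u (h (ga * w)) + Num.max u' (h (ga * z))
  - Num.max u (h (ga * z)) - Num.max u' (h (ga * w)).
(* This product is the difference of the symmetrized integrands; its two factors never have opposite
   signs. *)
have key : 0 <= (e - e') * br.
  have hle a b : a ^+ 2 <= b ^+ 2 -> h (ga * a) <= h (ga * b).
    move=> ab; apply: hm; rewrite !normrM ler_wpM2l//.
    by rewrite -ler_sqr ?nnegrE// !real_normK ?num_real.
  have case1 : (z - m) ^+ 2 <= (z - m') ^+ 2 -> w ^+ 2 <= z ^+ 2 ->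
      0 <= (e - e') * br.
    move=> /expR_le_sqr ee /hle hh; apply: mulr_ge0; first by rewrite subr_ge0.
    by rewrite /br; have := max_submodular _ _ _ _ uu hh; lra.
  have case2 : (z - m') ^+ 2 <= (z - m) ^+ 2 -> z ^+ 2 <= w ^+ 2 ->
      0 <= (e - e') * br.
    move=> /expR_le_sqr ee /hle hh; apply: mulr_le0; first by rewrite subr_le0.
    by rewrite /br; have := max_submodular _ _ _ _ uu hh; lra.
  have [mm'|mm'] := eqVneq m m'.
    by rewrite /e /e' mm' subrr mul0r.
  (* By [s2] the differences (z - m')^2 - (z - m)^2 and z^2 - w^2 have compatible signs: they are 2
     z - (m + m') times m - m' and m + m' respectively. *)
  have s2 : 0 <= (m - m') * (m + m') by rewrite -subr_sqr subr_ge0.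
  have zz : (z - m') ^+ 2 - (z - m) ^+ 2 = (m - m') * (2 * z - (m + m')) by ring.
  have zw : z ^+ 2 - w ^+ 2 = (m + m') * (2 * z - (m + m')) by rewrite /w; ring.
  have [lt|lt] : m' < m \/ m < m' by apply/orP; rewrite orbC -neq_lt.
    have s0 : 0 <= m + m' by move: s2; rewrite pmulr_rge0// subr_gt0.
    have [zs|zs] := leP (m + m') (2 * z).
      by apply: case1; rewrite -subr_ge0 ?zz ?zw mulr_ge0// subr_ge0// ltW.
    by apply: case2; rewrite -subr_le0 ?zz ?zw mulr_ge0_le0// ?subr_le0 ?subr_ge0// ltW.
  have s0 : m + m' <= 0 by move: s2; rewrite nmulr_rge0// subr_lt0.
  have [zs|zs] := leP (m + m') (2 * z).
    by apply: case2; rewrite -subr_le0 ?zz ?zw mulr_le0_ge0// ?subr_le0 ?subr_ge0// ltW.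
  by apply: case1; rewrite -subr_ge0 ?zz ?zw mulr_le0// ?subr_le0 ?subr_ge0// ltW.
by move: key; rewrite /br; lra.
Qed.
Lemma lee_pmul2l_fin (k : R) (x y : \bar R) : 0 < k ->
  (k%:E * x <= k%:E * y -> x <= y)%E.
Proof. by move=> k0; rewrite lee_pmul2l// lte_fin. Qed.

Lemma lee_double (x y : \bar R) : (x + x <= y + y -> x <= y)%E.
Proof.
by move=> xy; apply: (lee_pmul2l_fin 2) => //; rewrite !mule_natl !mule2n.
Qed.

(** For nonzero [ga] the substitution z = y + be / ga moves the shift from [h] to the Gaussian
    weight, where [shifted_rearrangement] applies; for [ga] zero the claim is pointwise. *)
Lemma gauss_section_submodular (h : R -> R) (u u' be be' ga : R) :
  measurable_fun setT h -> (forall x, 0 <= h x) -> even_mono h ->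
  u' <= u -> 0 <= u' -> `|be'| <= `|be| ->
  (\int[mu]_y (expR (- y ^+ 2) * (Num.max u (h (be + ga * y)) +
     Num.max u' (h (be' + ga * y))))%:E <=
   \int[mu]_y (expR (- y ^+ 2) * (Num.max u (h (be' + ga * y)) +
     Num.max u' (h (be + ga * y))))%:E)%E.
Proof.
move=> mh h0 hm uu u0 bb.
have M0 v x : 0 <= Num.max v (h x) by rewrite le_max h0 orbT.
have [ga0|ga0] := eqVneq ga 0.
  apply: ge0_le_integral; [exact: measurableT|..].
  - by move=> y _; rewrite lee_fin mulr_ge0 ?addr_ge0// expR_ge0.
  - by meas.
  - by meas.
  move=> y _; rewrite lee_fin ler_wpM2l ?expR_ge0// ga0 !mul0r !addr0.
  by apply: max_submodular => //; exact: hm.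
have shift v b : (\int[mu]_y (expR (- y ^+ 2) * Num.max v (h (b + ga * y)))%:E =
    \int[mu]_z (expR (- (z - b / ga) ^+ 2) * Num.max v (h (ga * z)))%:E)%E.
  rewrite -[RHS](integral_translation (b / ga)); last 2 first.
  - by meas.
  - by move=> z; rewrite lee_fin mulr_ge0// expR_ge0.
  apply: eq_integral => y _; rewrite addrK; congr (_ * Num.max _ (h _))%:E.
  by field.
have split2 v v' b b' : (\int[mu]_y (expR (- y ^+ 2) * (Num.max v (h (b + ga * y)) +
     Num.max v' (h (b' + ga * y))))%:E =
   \int[mu]_z (expR (- (z - b / ga) ^+ 2) * Num.max v (h (ga * z)) +
     expR (- (z - b' / ga) ^+ 2) * Num.max v' (h (ga * z)))%:E)%E.
  under eq_integral do rewrite mulrDr EFinD.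
  under [RHS]eq_integral do rewrite EFinD.
  rewrite !ge0_integralD//; do ?by [move=> *; rewrite lee_fin mulr_ge0// expR_ge0|meas].
  by rewrite !shift.
rewrite !split2; apply: shifted_rearrangement => //.
by rewrite !expr_div_n ler_wpM2r ?invr_ge0 ?sqr_ge0// -real_normK ?num_real//
  -[leRHS]real_normK ?num_real// ler_sqr ?nnegrE.
Qed.

Lemma integral3_swap12 K : measurable_fun setT K -> (forall z, 0 <= K z)%E ->
  integral3 (fun z : T * T * T => K (z.1.2, z.1.1, z.2)) = integral3 K.
Proof.
move=> mK K0; rewrite integral3E; last 2 first.
- by meas.
- by move=> z; exact: K0.
rewrite (integral3E _ mK K0) /= -(integral_swap (fun z => \int[mu]_c K (z.1, z.2, c))%E).
- by [].
- exact: measurable_integral3.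
- by move=> z; exact: integral_ge0.
Qed.

Lemma integral3D (A B : T * T * T -> R) :
  measurable_fun setT A -> measurable_fun setT B ->
  (forall z, 0 <= A z) -> (forall z, 0 <= B z) ->
  integral3 (fun z => (A z + B z)%:E) =
  (integral3 (fun z => (A z)%:E) + integral3 (fun z => (B z)%:E))%E.
Proof.
move=> mA mB A0 B0.
have mEA : measurable_fun setT (fun z => (A z)%:E) by meas.
have mEB : measurable_fun setT (fun z => (B z)%:E) by meas.
have EA0 z : (0 <= (A z)%:E)%E by rewrite lee_fin.
have EB0 z : (0 <= (B z)%:E)%E by rewrite lee_fin.
rewrite integral3E; last 2 first.
- by meas.
- by move=> z; rewrite lee_fin addr_ge0.
rewrite (integral3E _ mEA EA0) (integral3E _ mEB EB0).
rewrite -ge0_integralD; first last.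
- exact: (measurable_integral3 (fun z => (B z)%:E)).
- by move=> z _; exact: integral_ge0.
- exact: (measurable_integral3 (fun z => (A z)%:E)).
- by move=> z _; exact: integral_ge0.
- exact: measurableT.
apply: eq_integral => z _; under eq_integral do rewrite EFinD.
rewrite ge0_integralD; first last.
- by meas.
- by move=> y _; exact: EB0.
- by meas.
- by move=> y _; exact: EA0.
- exact: measurableT.
by [].
Qed.

(** An extra Gaussian coordinate costs the factor sqrt(pi); it makes room for a second, independent
    copy of the first coordinate. *)
Lemma integral3_gauss2 (a : T * T -> R) : measurable_fun setT a -> (forall z, 0 <= a z) ->
  (integral3 (fun z => (a (z.1.1, z.2) * expR (- z.1.2 ^+ 2))%:E) =
   g%:E * \int[mu2]_z (a z)%:E)%E.
Proof.
move=> ma a0.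
rewrite -(integral3_swap23 (fun z => (a (z.1.1, z.2) * expR (- z.1.2 ^+ 2))%:E)); last 2 first.
- by meas.
- by move=> z; rewrite lee_fin mulr_ge0// expR_ge0.
rewrite integral3E /=; last 2 first.
- by meas.
- by move=> z; rewrite lee_fin mulr_ge0// expR_ge0.
rewrite -ge0_integralZl_EFin//; last 2 first.
- by move=> z _; rewrite lee_fin.
- by meas.
apply: eq_integral => -[x y] _ /=.
under eq_integral do rewrite EFinM.
rewrite ge0_integralZl_EFin//; last by meas.
by rewrite muleC; congr (_ * _)%E; exact: integralT_gauss.
Qed.

(* Sidak's inequality for two strips, in integrated form: the level sets of
   f and h are intervals centered at the origin. *)
Lemma gauss_planar_le_orthogonal (f h : R -> R) (al be ga : R) :
  measurable_fun setT f -> (forall x, 0 <= f x) -> even_mono f ->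
  measurable_fun setT h -> (forall x, 0 <= h x) -> even_mono h ->
  exists2 r, r ^+ 2 = be ^+ 2 + ga ^+ 2 &
  (gauss_planar (fun z => Num.max (f z.1) (h z.2)) al be ga <=
   gauss_planar (fun z => Num.max (f z.1) (h z.2)) al 0 r)%E.
Proof.
move=> mf f0 fm mh h0 hm.
have M0 a b : 0 <= Num.max (f a) (h b) by rewrite le_max f0.
have [r [c [s [cs gaE beE]]]] := polar_coordinates ga be.
exists r; first by rewrite gaE beE !exprMn -mulrDr addrC cs mulr1.
pose w (z : T * T * T) := expR (- z.1.1 ^+ 2) * expR (- z.1.2 ^+ 2) * expR (- z.2 ^+ 2).
have mw : measurable_fun setT w by rewrite /w; meas.
have w0 z : 0 <= w z by rewrite /w !mulr_ge0 ?expR_ge0.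
(* Two independent copies x, x' of the first coordinate share the second one, y. In [S11] and [S22]
   the arguments of [f] and [h] use the same copy; in [S12] and [S21] they use different ones and
   are independent. *)
pose S11 z := w z * Num.max (f (al * z.1.1)) (h (be * z.1.1 + ga * z.2)).
pose S22 z := w z * Num.max (f (al * z.1.2)) (h (be * z.1.2 + ga * z.2)).
pose S12 z := w z * Num.max (f (al * z.1.1)) (h (be * z.1.2 + ga * z.2)).
pose S21 z := w z * Num.max (f (al * z.1.2)) (h (be * z.1.1 + ga * z.2)).
have m11 : measurable_fun setT S11 by rewrite /S11; meas.
have m22 : measurable_fun setT S22 by rewrite /S22; meas.
have m12 : measurable_fun setT S12 by rewrite /S12; meas.
have m21 : measurable_fun setT S21 by rewrite /S21; meas.
have p11 z : 0 <= S11 z by rewrite mulr_ge0.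
have p22 z : 0 <= S22 z by rewrite mulr_ge0.
have p12 z : 0 <= S12 z by rewrite mulr_ge0.
have p21 z : 0 <= S21 z by rewrite mulr_ge0.
have JE b c' : (g%:E * gauss_planar (fun z => Num.max (f z.1) (h z.2)) al b c')%E =
    integral3 (fun z => (w z * Num.max (f (al * z.1.1)) (h (b * z.1.1 + c' * z.2)))%:E).
  rewrite /gauss_planar -integral3_gauss2; last 2 first.
  - by meas.
  - by move=> z; rewrite mulr_ge0// expR_ge0.
  congr integral3; apply/funext => z; rewrite /w /= expRD; congr EFin; ring.
have I11 : integral3 (fun z => (S11 z)%:E) =
    (g%:E * gauss_planar (fun z => Num.max (f z.1) (h z.2)) al be ga)%E.
  by rewrite JE.
have I22 : integral3 (fun z => (S22 z)%:E) = integral3 (fun z => (S11 z)%:E).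
  rewrite -(integral3_swap12 (fun z => (S11 z)%:E)); last 2 first.
  - by meas.
  - by move=> z; rewrite lee_fin.
  by congr integral3; apply/funext => z; rewrite /S11 /S22 /w /= [X in X * _ * _]mulrC.
have I21 : integral3 (fun z => (S21 z)%:E) = integral3 (fun z => (S12 z)%:E).
  rewrite -(integral3_swap12 (fun z => (S12 z)%:E)); last 2 first.
  - by meas.
  - by move=> z; rewrite lee_fin.
  by congr integral3; apply/funext => z; rewrite /S12 /S21 /w /= [X in X * _ * _]mulrC.
pose S z := w z * Num.max (f (al * z.1.2)) (h (r * z.2)).
have I12 : integral3 (fun z => (S12 z)%:E) =
    (g%:E * gauss_planar (fun z => Num.max (f z.1) (h z.2)) al 0 r)%E.
  rewrite -I21 JE.
  transitivity (integral3 (fun z => (S z)%:E)).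
    (* Rotating (x, y) turns be x + ga y into r y. *)
    rewrite -(integral3_rotation13 c s (fun z => (S z)%:E) cs); last 2 first.
    - by rewrite /S; meas.
    - by move=> z; rewrite lee_fin mulr_ge0.
    congr integral3; apply/funext => z; rewrite /S21 /S /w /= -!expRD gaE beE.
    congr (expR _ * Num.max _ (h _))%:E; last by ring.
    transitivity ((c ^+ 2 + s ^+ 2) * - z.1.1 ^+ 2 + - z.1.2 ^+ 2 +
      (c ^+ 2 + s ^+ 2) * - z.2 ^+ 2); last by ring.
    by rewrite cs !mul1r.
  rewrite -(integral3_swap12 (fun z => (S z)%:E)); last 2 first.
  - by rewrite /S; meas.
  - by move=> z; rewrite lee_fin mulr_ge0.
  congr integral3; apply/funext => z; rewrite /S /w /= mul0r add0r; congr (_ * _)%:E.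
  by rewrite [X in X * _]mulrC.
have : (integral3 (fun z => (S11 z + S22 z)%:E) <= integral3 (fun z => (S12 z + S21 z)%:E))%E.
  rewrite (integral3E (fun z => (S11 z + S22 z)%:E)); last 2 first.
  - by meas.
  - by move=> z; rewrite lee_fin addr_ge0.
  rewrite (integral3E (fun z => (S12 z + S21 z)%:E)); last 2 first.
  - by meas.
  - by move=> z; rewrite lee_fin addr_ge0.
  apply: ge0_le_integral; [exact: measurableT|..].
  - by move=> z _; apply: integral_ge0 => y _; rewrite lee_fin addr_ge0.
  - apply: (measurable_integral3 (fun z => (S11 z + S22 z)%:E)); first by meas.
    by move=> z; rewrite lee_fin addr_ge0.
  - apply: (measurable_integral3 (fun z => (S12 z + S21 z)%:E)); first by meas.
    by move=> z; rewrite lee_fin addr_ge0.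
  (* For fixed x, x' it remains to compare integrals over y; the constant weight [k] factors out. *)
  move=> [x x'] _ /=; pose k := expR (- x ^+ 2) * expR (- x' ^+ 2).
  have pull (u u' b b' : R) : 0 <= u -> 0 <= u' ->
     (\int[mu]_y (k * expR (- y ^+ 2) * Num.max u (h (b + ga * y)) +
        k * expR (- y ^+ 2) * Num.max u' (h (b' + ga * y)))%:E =
      k%:E * \int[mu]_y (expR (- y ^+ 2) * (Num.max u (h (b + ga * y)) +
        Num.max u' (h (b' + ga * y))))%:E)%E.
    move=> u0 u'0; rewrite -integralRZl; last 3 first.
    - by rewrite mulr_ge0 ?expR_ge0.
    - by meas.
    - move=> y; apply: mulr_ge0; first exact: expR_ge0.
      by apply: addr_ge0; rewrite le_max h0 orbT.
    by apply: eq_integral => y _; rewrite -mulrDr mulrA.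
  rewrite /S11 /S22 /S12 /S21 /w /=.
  rewrite (pull _ _ _ _ (f0 _) (f0 _)) (pull _ _ _ _ (f0 _) (f0 _)).
  apply: lee_wpmul2l; first by rewrite lee_fin mulr_ge0 ?expR_ge0.
  have scale b y y' : `|y| <= `|y'| :> R -> `|b * y| <= `|b * y'|.
    by move=> yy; rewrite !normrM ler_wpM2l.
  (* The values of [f] and the sizes of the shifts be x, be x' are ordered in the same way, by |x|
     and |x'|. *)
  have [xx|/ltW xx] := leP `|x'| `|x|.
    exact: (gauss_section_submodular _ _ _ _ _ _ mh h0 hm (fm _ _ (scale _ _ _ xx))
      (f0 _) (scale _ _ _ xx)).
  under eq_integral do rewrite addrC.
  under [leRHS]eq_integral do rewrite addrC.
  exact: (gauss_section_submodular _ _ _ _ _ _ mh h0 hm (fm _ _ (scale _ _ _ xx))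
    (f0 _) (scale _ _ _ xx)).
rewrite (integral3D _ _ m11 m22 p11 p22) (integral3D _ _ m12 m21 p12 p21) I22 I21 I11 I12.
move=> /lee_double /(lee_pmul2l_fin _ _ _ sqrt_pi_gt0); exact.
Qed.

End sidak.

(** * Gaussian mass of truncated sectors *)

Section slope.
Context {R : realType}.
Notation T := (measurableTypeR R).
Notation mu := (@lebesgue_measure R).
Notation mu2 := (mu \x mu)%E.

Lemma derivable_continuous (f : R -> R) :
  (forall x, derivable f x 1) -> continuous f.
Proof. by move=> df x; apply/differentiable_continuous/derivable1_diffP. Qed.

Lemma integral_x_gauss (h k : R) : 0 <= h -> 0 < k ->
  (\int[mu]_(x in `[h, +oo[) (x * expR (- (k * x ^+ 2)))%:E =
   (expR (- (k * h ^+ 2)) / (2 * k))%:E)%E.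
Proof.
move=> h0 k0.
pose F (x : R) := - (2 * k)^-1 * expR (- (k * x ^+ 2)).
have dF (x : R) : is_derive x 1 F (x * expR (- (k * x ^+ 2))).
  apply: is_derive_eq; rewrite /GRing.scale /=.
  by field; exact: lt0r_neq0.
have df (x : R) : derivable (fun x : R => x * expR (- (k * x ^+ 2))) x 1.
  exact: ex_derive.
rewrite (@ge0_continuous_FTC2y _ _ F _ 0).
- rewrite -EFinB sub0r /F mulNr opprK mulrC //.
- by move=> x hx; rewrite mulr_ge0 ?expR_ge0// (le_trans h0).
- by apply: continuous_subspaceT; exact: derivable_continuous.
- rewrite -[X in _ --> X](mulr0 (- (2 * k)^-1)); apply: cvgMl_tmp.
  have : (k * x ^+ 2) @[x --> +oo%R] --> +oo%R.
    by apply: gt0_cvgMry => //; exact: cvgr_expr2.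
  move=> kx.
  by apply: (cvg_comp (fun x => k * x ^+ 2) (fun x => expR (- x)) kx); exact: cvgr_expR.
- by move=> x _; apply: ex_derive.
- apply: cvg_at_right_filter; apply: derivable_continuous => x; apply: ex_derive.
- by move=> x _; rewrite derive1E; exact: derive_val.
Qed.

Lemma integral_boolR (i : interval R) (f : R -> \bar R) :
  (\int[mu]_(x in [set` i]) f x = \int[mu]_x ((x \in i)%:R%:E * f x))%E.
Proof.
rewrite integral_mkcond; apply: eq_integral => x _; rewrite patchE mem_setE.
by case: ifP => _; rewrite ?mul1e ?mul0e.
Qed.

(** The integral of u exp(-(1 + s^2) u^2) over u > h, where the factor u is the Jacobian of (u, s)
    -> (u, u s). *)
Definition sector_density (h s : R) :=
  expR (- ((1 + s ^+ 2) * h ^+ 2)) / (2 * (1 + s ^+ 2)).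

(* The Gaussian mass of a union of truncated sectors, given by the slopes
   s = v / u of its rays. *)
Lemma gauss_sector (b : bool) (h : R) (q : T * T -> bool) (tau : R -> bool) :
  0 <= h -> measurable_fun setT q -> measurable_fun setT tau ->
  (forall u s, 0 < u -> q (u, u * s) = tau s) ->
  (\int[mu2]_z (((z.1 \in Interval (BSide b h) +oo%O) && q z)%:R *
     expR (- z.1 ^+ 2 - z.2 ^+ 2))%:E =
   \int[mu]_s ((tau s)%:R * sector_density h s)%:E)%E.
Proof.
move=> h0 mq mtau qtau.
have mi b' : measurable_fun [set: T] (fun x : T => x \in Interval (BSide b' h) +oo%O).
  have -> : (fun x : T => x \in Interval (BSide b' h) +oo%O) =
      if b' then fun x => h <= x else fun x => h < x.
    by apply/funext => x; case: b'; rewrite in_itv /= andbT.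
  by case: b'; meas.
have mi1 b' : measurable_fun [set: T * T] (fun z : T * T =>
    z.1 \in Interval (BSide b' h) +oo%O).
  by apply: (measurableT_comp (mi b')); exact: measurable_fst.
pose G u := (\int[mu]_v ((q (u, v))%:R * expR (- u ^+ 2 - v ^+ 2))%:E)%E.
have mG : measurable_fun [set: T] G.
  apply: (measurable_fun_fubini_tonelli_F
    (fun z : T * T => ((q z)%:R * expR (- z.1 ^+ 2 - z.2 ^+ 2))%:E)).
    by meas.
  by move=> z; rewrite lee_fin mulr_ge0 ?expR_ge0.
transitivity (\int[mu]_(u in `[h, +oo[) G u)%E.
  transitivity (\int[mu]_(u in [set` Interval (BSide b h) +oo%O]) G u)%E.
    rewrite integral_boolR integral12; last 2 first.
    - have mib := mi1 b; by meas.
    - by move=> z; rewrite lee_fin mulr_ge0 ?expR_ge0.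
    apply: eq_integral => u _; rewrite /G -integralRZl; last 3 first.
    - by [].
    - by meas.
    - by move=> v; rewrite mulr_ge0 ?expR_ge0.
    by apply: eq_integral => v _ /=; rewrite mulrA -natrM mulnb.
  case: b mi => mi; first by [].
  by apply: integral_itv_obnd_cbnd; exact: measurable_funTS.
(* Leaving out the null endpoint makes u positive even if h = 0, as the substitution v = u s
   requires. *)
rewrite -integral_itv_obnd_cbnd; last exact: measurable_funTS.
pose H (z : T * T) := (z.1 \in `]h, +oo[)%:R * ((tau z.2)%:R *
  (z.1 * expR (- ((1 + z.2 ^+ 2) * z.1 ^+ 2)))).
have H0 z : 0 <= H z.
  rewrite /H; have [|_] := boolP (z.1 \in _); last by rewrite mul0r.
  rewrite in_itv /= andbT => hz.
  by rewrite !mulr_ge0 ?expR_ge0// (le_trans h0)// ltW.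
have mH : measurable_fun setT H by rewrite /H; have mib := mi1 false; meas.
have EH0 z : (0 <= (H z)%:E)%E by rewrite lee_fin.
have mEH : measurable_fun setT (fun z => (H z)%:E) by meas.
transitivity (\int[mu]_u \int[mu]_s (H (u, s))%:E)%E.
  rewrite integral_boolR; apply: eq_integral => u _.
  rewrite /H /=; have [|_] := boolP (u \in _); last first.
    by rewrite mul0e; under eq_integral do rewrite mul0r; rewrite integral0.
  rewrite in_itv /= andbT mul1e => hu.
  have u0 : 0 < u by exact: le_lt_trans hu.
  rewrite /G (integral_affine_gt0 u 0 u0); last 2 first.
  - by meas.
  - by move=> v; rewrite lee_fin mulr_ge0 ?expR_ge0.
  rewrite -integralRZl; last 3 first.
  - exact: ltW.
  - by meas.
  - by move=> v; rewrite mulr_ge0 ?expR_ge0.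
  apply: eq_integral => s _; rewrite addr0 mul1r qtau// mulrCA.
  by congr (_ * (_ * expR _))%:E; ring.
(* After exchanging the integrals, the one in u is elementary for each slope. *)
rewrite -(integral12 (fun z => (H z)%:E) mEH EH0) (integral21 _ mEH EH0).
apply: eq_integral => s _.
have k0 : 0 < 1 + s ^+ 2 by rewrite ltr_pwDl ?sqr_ge0.
rewrite /sector_density EFinM -integral_x_gauss//.
rewrite -integral_itv_obnd_cbnd; last by meas.
rewrite integral_boolR; under [in RHS]eq_integral do rewrite -EFinM.
rewrite -integralRZl; last 3 first.
- by [].
- by have mib := mi false; meas.
- move=> u; have [|_] := boolP (u \in _); last by rewrite mul0r.
  rewrite in_itv /= andbT => hu.
  by rewrite !mulr_ge0 ?expR_ge0// (le_trans h0)// ltW.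
by apply: eq_integral => u _; rewrite /H /= mulrCA.
Qed.

End slope.

(** * Voronoi decomposition of the quadrant *)

Section quadrant.
Context {R : realType}.
Notation T := (measurableTypeR R).
Notation mu := (@lebesgue_measure R).
Notation mu2 := (mu \x mu)%E.
Implicit Types F : R * R -> R.

Lemma integral_null_line F : measurable_fun setT F -> (forall z, 0 <= F z) ->
  (\int[mu2]_z (ind (z.1 == 0) * F z)%:E = 0)%E.
Proof.
move=> mF F0; rewrite integral12; last 2 first.
- by meas.
- by move=> z; rewrite lee_fin mulr_ge0.
transitivity (\int[mu]_(x in `[0%R, 0%R]) \int[mu]_y (F (x, y))%:E)%E.
  rewrite integral_boolR; apply: eq_integral => x _ /=.
  rewrite itvxx inE -integralRZl; [by []|by []|by meas|by move=> y].
by rewrite set_itv1 integral_set1.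
Qed.

Lemma integral_even1 F : measurable_fun setT F -> (forall z, 0 <= F z) ->
  (forall z, F (- z.1, z.2) = F z) ->
  (\int[mu2]_z (F z)%:E = 2%:E * \int[mu2]_z (ind (0 <= z.1) * F z)%:E)%E.
Proof.
move=> mF F0 ev.
pose F1 (z : R * R) := ind (0 <= z.1) * F z + ind (z.1 < 0) * F z.
transitivity (\int[mu2]_z (F1 z)%:E)%E; rewrite /F1 {F1}.
  apply: eq_integral => z _; congr EFin.
  by case: ltP => _; rewrite mul1r mul0r ?add0r ?addr0.
rewrite integralRD; last 4 first.
- by meas.
- by meas.
- by move=> z; rewrite mulr_ge0.
- by move=> z; rewrite mulr_ge0.
rewrite mule_natl mule2n; congr (_ + _)%E.
rewrite -integral_opp1; last 2 first.
- by meas.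
- by move=> z; rewrite lee_fin mulr_ge0.
(* Up to the reflection the two halves differ by the line z.1 = 0, which is null. *)
rewrite -[LHS]adde0 -[X in (_ + X)%E](integral_null_line F mF F0).
rewrite -integralRD; last 4 first.
- by meas.
- by meas.
- by move=> z; rewrite mulr_ge0.
- by move=> z; rewrite mulr_ge0.
apply: eq_integral => z _; rewrite /= oppr_ge0 ev; congr EFin.
by case: ltgtP => _; rewrite ?mul1r ?mul0r ?add0r ?addr0.
Qed.

Lemma integral_even2 F : measurable_fun setT F -> (forall z, 0 <= F z) ->
  (forall z, F (z.1, - z.2) = F z) ->
  (\int[mu2]_z (F z)%:E = 2%:E * \int[mu2]_z (ind (0 <= z.2) * F z)%:E)%E.
Proof.
move=> mF F0 ev.
rewrite -integral_swap; last 2 first.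
- by meas.
- by move=> z; rewrite lee_fin.
rewrite (integral_even1 (fun z => F (z.2, z.1))); last 3 first.
- by meas.
- by [].
- by move=> z; rewrite -[RHS]ev.
congr (_ * _)%E; rewrite -[RHS]integral_swap; last 2 first.
- by meas.
- by move=> z; rewrite lee_fin mulr_ge0.
by [].
Qed.

Lemma integral_quadrant F : measurable_fun setT F -> (forall z, 0 <= F z) ->
  (forall z, F (- z.1, z.2) = F z) -> (forall z, F (z.1, - z.2) = F z) ->
  (\int[mu2]_z (F z)%:E =
   4%:E * \int[mu2]_z (ind ((0 <= z.1) && (0 <= z.2)) * F z)%:E)%E.
Proof.
move=> mF F0 ev1 ev2; rewrite (integral_even1 F)// integral_even2; last 3 first.
- by meas.
- by move=> z; rewrite mulr_ge0.
- by move=> z; rewrite /= ev2.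
rewrite muleA -EFinM (_ : 2 * 2 = 4 :> R); last by ring.
congr (_ * _)%E; apply: eq_integral => z _.
by rewrite mulrA -natrM mulnb andbC.
Qed.

End quadrant.

(** * Truncated sectors cut off by the Voronoi cells *)

Section planar.
Context {R : realType}.
Notation T := (measurableTypeR R).
Notation mu := (@lebesgue_measure R).
Notation mu2 := (mu \x mu)%E.
Variables (a b : R) (b0 : 0 <= b) (ba : b <= a) (a0 : 0 < a).

Let eA (z : R * R) : R := expR (- (z.1 - a) ^+ 2 - z.2 ^+ 2).
Let eB (z : R * R) : R := expR (- z.1 ^+ 2 - (z.2 - b) ^+ 2).

(* [closer_B z]: z is closer to (0, b) than to (a, 0); [side z >= 0]: z lies
   above the ray from (0, b) through the vertex of the Voronoi cell of (a, 0). *)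
Let closer_B (z : R * R) := 2 * a * z.1 - a ^+ 2 < 2 * b * z.2 - b ^+ 2.
Let side (z : R * R) := 2 * a * b * z.1 - (a ^+ 2 - b ^+ 2) * (b - z.2).

(** Excess count. The half-plane y >= 0 weighted from (a, 0) contains, besides the cell of (a, 0),
    the points closer to (0, b). The half-plane x >= 0 weighted from (0, b) contains, besides the
    cell of (0, b), the points beyond the bisector or below the axis, which the line [side] = 0
    divides into two truncated sectors. *)
Lemma voronoi_decomposition (z : R * R) :
  ind ((0 <= z.1) && (0 <= z.2)) * Num.max (eA z) (eB z) +
    ind ((0 <= z.2) && closer_B z) * eA z +
    ind (~~ closer_B z && (0 <= side z)) * eB z +
    ind [&& 0 <= z.1, z.2 < 0 & side z < 0] * eB z =
  ind (0 <= z.2) * eA z + ind (0 <= z.1) * eB z.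
Proof.
case: z => x y; rewrite /=.
have maxE : Num.max (eA (x, y)) (eB (x, y)) =
    if closer_B (x, y) then eB (x, y) else eA (x, y).
  rewrite /Num.max; congr (if _ then _ else _).
  rewrite ltr_expR /closer_B /=; apply/idP/idP; lra.
rewrite maxE /closer_B /side /=.
have ab : 0 <= a ^+ 2 - b ^+ 2 by rewrite subr_ge0 ler_sqr ?nnegrE// ltW.
set s := 2 * a * b * x - _.
(* The bisector, the axis y = 0 and the line [side] = 0 are concurrent; this relation yields the
   sign of one expression from the other two. *)
have sE : s = b * (2 * a * x - a ^+ 2 - (2 * b * y - b ^+ 2)) +
  (a ^+ 2 + b ^+ 2) * y by rewrite /s; ring.
have c0 : 0 < a ^+ 2 + b ^+ 2 by rewrite ltr_wpDr ?sqr_ge0// exprn_gt0.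
have [x0|x0] := leP 0 x; have [y0|y0] := leP 0 y; rewrite /= ?mul0r ?mul1r ?addr0 ?add0r.
- have [C|C] := ltP; rewrite /= ?mul0r ?mul1r ?addr0 ?add0r; first by rewrite addrC.
  by rewrite sE addr_ge0 ?mul1r// mulr_ge0// ?subr_ge0// ltW.
- have [S|S] := leP 0 s; rewrite /= ?mul1r ?mul0r ?andbT ?andbF ?mul0r ?addr0 ?add0r ?mul1r//.
  have cy : (a ^+ 2 + b ^+ 2) * y < 0 by rewrite pmulr_rlt0.
  rewrite (_ : (_ < _) = false) ?mul1r//; apply/negbTE; rewrite -leNgt -subr_ge0.
  rewrite leNgt; apply/negP => D0.
  have := mulr_ge0_le0 b0 (ltW D0); lra.
(* For x < 0 <= y the point (0, b) is always the closer one, because b <= a. *)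
- have ax : a * x < 0 by rewrite pmulr_rlt0.
  have by0 := mulr_ge0 b0 y0.
  by rewrite (_ : (_ < _) = true) /= ?mul1r ?mul0r ?addr0//; apply/idP; lra.
- rewrite (_ : _ && _ = false) ?mul0r//; apply/negbTE/negP => /andP[_ S].
  have cy : (a ^+ 2 + b ^+ 2) * y < 0 by rewrite pmulr_rlt0.
  have [b00|b00] := eqVneq b 0; first by move: S; rewrite sE b00 in cy *; lra.
  have bp : 0 < b by rewrite lt0r b00.
  have abx : a * b * x < 0 by rewrite pmulr_rlt0// mulr_gt0.
  have bmy : 0 <= b - y by rewrite subr_ge0 (le_trans (ltW y0)).
  by have := mulr_ge0 ab bmy; move: S; rewrite /s; lra.
Qed.

Let gam (z : R * R) : R := expR (- z.1 ^+ 2 - z.2 ^+ 2).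
Let c := Num.sqrt (a ^+ 2 + b ^+ 2).
Let h := c / 2.

Let c2 : c ^+ 2 = a ^+ 2 + b ^+ 2.
Proof. by rewrite sqr_sqrtr// addr_ge0 ?sqr_ge0. Qed.

Let c0 : 0 < c.
Proof. by rewrite sqrtr_gt0 ltr_wpDr ?sqr_ge0// exprn_gt0. Qed.

Let cos2 : (a / c) ^+ 2 + (b / c) ^+ 2 = 1.
Proof. by rewrite !expr_div_n -mulrDl -c2 mulfV// expf_neq0// gt_eqF. Qed.

Let meA : measurable_fun setT eA. Proof. by rewrite /eA; meas. Qed.
Let meB : measurable_fun setT eB. Proof. by rewrite /eB; meas. Qed.
Let mcloser : measurable_fun setT closer_B.
Proof. by rewrite /closer_B; meas. Qed.
Let mside : measurable_fun setT side.
Proof. by rewrite /side; meas. Qed.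

Let ind_ge0 (p : bool) (x : R) : 0 <= x -> (0 <= (p%:R * x)%:E)%E.
Proof. by move=> x0; rewrite lee_fin mulr_ge0. Qed.

Lemma integral_halfplaneA :
  (\int[mu2]_z (ind (0 <= z.2) * eA z)%:E =
   \int[mu2]_z (ind (0 <= z.2) * gam z)%:E)%E.
Proof.
rewrite -(integral_shear1 0 a); last 2 first.
- by meas.
- by move=> z; rewrite ind_ge0 ?expR_ge0.
by apply: eq_integral => z _; rewrite /eA /gam /= mul0r addr0 addrK.
Qed.

Lemma integral_halfplaneB :
  (\int[mu2]_z (ind (0 <= z.1) * eB z)%:E =
   \int[mu2]_z (ind (0 <= z.1) * gam z)%:E)%E.
Proof.
rewrite -(integral_shear2 0 b); last 2 first.
- by meas.
- by move=> z; rewrite ind_ge0 ?expR_ge0.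
by apply: eq_integral => z _; rewrite /eB /gam /= mul0r addr0 addrK.
Qed.

Let q (z : R * R) := 0 <= b * z.1 - a * z.2.

Let q_slope u s : 0 < u -> q (u, u * s) = (a * s <= b).
Proof.
move=> u0; rewrite /q /= (_ : _ - _ = u * (b - a * s)); last by ring.
by rewrite pmulr_rge0// subr_ge0.
Qed.

(** Move (a, 0) to the origin and turn the u-axis towards (0, b): the bisector becomes u = h, half
    the side of the rhombus, and the axis y = 0 contributes the slope b / a. *)
Lemma integral_lostA :
  (\int[mu2]_z (ind ((0 <= z.2) && closer_B z) * eA z)%:E =
   \int[mu]_s (ind (a * s <= b) * sector_density h s)%:E)%E.
Proof.
rewrite -(gauss_sector false h q (fun s => a * s <= b)); last 4 first.
- by rewrite divr_ge0// ltW.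
- by rewrite /q; meas.
- by meas.
- exact: q_slope.
rewrite -(integral_shear1 0 a); last 2 first.
- by meas.
- by move=> z; rewrite ind_ge0 ?expR_ge0.
rewrite -(integral_rotation (- (a / c)) (b / c)); last 3 first.
- by rewrite sqrrN.
- by meas.
- by move=> z; rewrite ind_ge0 ?expR_ge0.
(* With opaque names for the cosine and sine, [a] and [b] are multiples of [c] and the claims become
   polynomial identities modulo p^2 + r^2 = 1. *)
have [p pE] : exists p, p = a / c by exists (a / c).
have [r rE] : exists r, r = b / c by exists (b / c).
have aE : a = p * c by rewrite pE divfK// gt_eqF.
have bE : b = r * c by rewrite rE divfK// gt_eqF.
move: cos2; rewrite -pE -rE => pr.
apply: eq_integral => -[u v] _; congr EFin; congr (ind _ * _).
- rewrite andbC in_itv /= andbT; congr (_ && _).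
    rewrite /closer_B /= -subr_gt0 (_ : _ - _ = 2 * c * (u - h)).
      by rewrite pmulr_rgt0 ?mulr_gt0// subr_gt0.
    transitivity ((p ^+ 2 + r ^+ 2) * (2 * c * u - c ^+ 2)).
      by rewrite aE bE; ring.
    by rewrite pr /h; field.
  rewrite /q /= (_ : b * u - a * v = c * (r * u + - p * v)) ?pmulr_rge0//.
  by rewrite aE bE; ring.
- rewrite /eA /=; congr expR.
  transitivity (- (p ^+ 2 + r ^+ 2) * (u ^+ 2 + v ^+ 2)); first by ring.
  by rewrite pr; ring.
Qed.

(** Up to its boundary this region is the mirror image, in the bisector, of the sector lost by (a,
    0); hence the reflection in the change of variables and the same right-hand side. *)
Lemma integral_lostB :
  (\int[mu2]_z (ind (~~ closer_B z && (0 <= side z)) * eB z)%:E =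
   \int[mu]_s (ind (a * s <= b) * sector_density h s)%:E)%E.
Proof.
rewrite -(gauss_sector true h q (fun s => a * s <= b)); last 4 first.
- by rewrite divr_ge0// ltW.
- by rewrite /q; meas.
- by meas.
- exact: q_slope.
rewrite -(integral_shear2 0 b); last 2 first.
- by meas.
- by move=> z; rewrite ind_ge0 ?expR_ge0.
rewrite -integral_opp2; last 2 first.
- by meas.
- by move=> z; rewrite ind_ge0 ?expR_ge0.
rewrite -(integral_rotation (a / c) (b / c)); last 3 first.
- by [].
- by meas.
- by move=> z; rewrite ind_ge0 ?expR_ge0.
have [p pE] : exists p, p = a / c by exists (a / c).
have [r rE] : exists r, r = b / c by exists (b / c).
have aE : a = p * c by rewrite pE divfK// gt_eqF.
have bE : b = r * c by rewrite rE divfK// gt_eqF.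
move: cos2; rewrite -pE -rE => pr.
apply: eq_integral => -[u v] _; congr EFin; congr (ind _ * _).
- rewrite in_itv /= andbT; congr (_ && _).
    rewrite /closer_B /= -subr_gt0 (_ : _ - _ = 2 * c * (h - u)).
      by rewrite -leNgt pmulr_rle0 ?mulr_gt0// subr_le0.
    transitivity ((p ^+ 2 + r ^+ 2) * (c ^+ 2 - 2 * c * u)).
      by rewrite aE bE; ring.
    by rewrite pr /h; field.
  rewrite /q /side /= (_ : _ - _ * (_ - _) = c * (b * u - a * v)) ?pmulr_rge0//.
  transitivity ((p ^+ 2 + r ^+ 2) * (c ^+ 2 * (r * u - p * v))).
    by rewrite aE bE; ring.
  by rewrite pr aE bE; ring.
- rewrite /eB /=; congr expR.
  transitivity (- (p ^+ 2 + r ^+ 2) * (u ^+ 2 + v ^+ 2)); first by ring.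
  by rewrite pr; ring.
Qed.

(** Seen from (0, b) with the u-axis pointing down, the axis y = 0 lies at distance [b], and [side]
    < 0 bounds the slope by (a^2 - b^2) / (2 a b). Written without division, the bound admits b = 0,
    where every slope s >= 0 is allowed. *)
Lemma integral_lostC :
  (\int[mu2]_z (ind [&& 0 <= z.1, z.2 < 0 & side z < 0] * eB z)%:E =
   \int[mu]_s (ind ((0 <= s) && (2 * a * b * s < a ^+ 2 - b ^+ 2)) *
     sector_density b s)%:E)%E.
Proof.
rewrite -(gauss_sector false b (fun z : R * R => (0 <= z.2) &&
  (2 * a * b * z.2 < (a ^+ 2 - b ^+ 2) * z.1))); last 4 first.
- by [].
- by meas.
- by meas.
- move=> u s u0 /=; rewrite pmulr_rge0//; congr (_ && _).
  by rewrite mulrCA [_ * u]mulrC ltr_pM2l.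
rewrite -(integral_shear2 0 b); last 2 first.
- by meas.
- by move=> z; rewrite ind_ge0 ?expR_ge0.
rewrite -integral_opp2; last 2 first.
- by meas.
- by move=> z; rewrite ind_ge0 ?expR_ge0.
rewrite -integral_swap; last 2 first.
- by meas.
- by move=> z; rewrite ind_ge0 ?expR_ge0.
apply: eq_integral => -[u v] _; congr EFin; congr (ind _ * _).
  rewrite in_itv /= andbT mul0r addr0 andbCA addrC subr_lt0; congr [&& _, _ & _].
  rewrite /side /=; apply/idP/idP; lra.
rewrite /eB /=; congr expR; ring.
Qed.

(** Integration of [voronoi_decomposition], with the lost masses added on the left to avoid
    subtracting extended reals. The right-hand side is the same for all [a] and [b], and [h] depends
    on a^2 + b^2 only. *)
Lemma planar_identity :
  (\int[mu2]_z (ind ((0 <= z.1) && (0 <= z.2)) * Num.max (eA z) (eB z))%:E +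
   \int[mu]_s (ind (a * s <= b) * sector_density h s)%:E +
   \int[mu]_s (ind (a * s <= b) * sector_density h s)%:E +
   \int[mu]_s (ind ((0 <= s) && (2 * a * b * s < a ^+ 2 - b ^+ 2)) *
     sector_density b s)%:E =
   \int[mu2]_z (ind (0 <= z.2) * gam z)%:E +
   \int[mu2]_z (ind (0 <= z.1) * gam z)%:E)%E.
Proof.
pose f1 (z : R * R) := ind ((0 <= z.1) && (0 <= z.2)) * Num.max (eA z) (eB z).
pose f2 (z : R * R) := ind ((0 <= z.2) && closer_B z) * eA z.
pose f3 (z : R * R) := ind (~~ closer_B z && (0 <= side z)) * eB z.
pose f4 (z : R * R) := ind [&& 0 <= z.1, z.2 < 0 & side z < 0] * eB z.
pose g1 (z : R * R) := ind (0 <= z.2) * eA z.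
pose g2 (z : R * R) := ind (0 <= z.1) * eB z.
have m1 : measurable_fun setT f1 by rewrite /f1; meas.
have m2 : measurable_fun setT f2 by rewrite /f2; meas.
have m3 : measurable_fun setT f3 by rewrite /f3; meas.
have m4 : measurable_fun setT f4 by rewrite /f4; meas.
have n1 : measurable_fun setT g1 by rewrite /g1; meas.
have n2 : measurable_fun setT g2 by rewrite /g2; meas.
have p1 z : 0 <= f1 z by rewrite mulr_ge0// le_max expR_ge0.
have p2 z : 0 <= f2 z by rewrite mulr_ge0// expR_ge0.
have p3 z : 0 <= f3 z by rewrite mulr_ge0// expR_ge0.
have p4 z : 0 <= f4 z by rewrite mulr_ge0// expR_ge0.
have q1 z : 0 <= g1 z by rewrite mulr_ge0// expR_ge0.
have q2 z : 0 <= g2 z by rewrite mulr_ge0// expR_ge0.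
rewrite -{1}integral_lostA -integral_lostB -integral_lostC.
rewrite -integral_halfplaneA -integral_halfplaneB.
rewrite -(@integralRD _ _ _ mu2 f1 f2 m1 m2 p1 p2).
rewrite -(@integralRD _ _ _ mu2 _ f3 _ m3 _ p3); last 2 first.
- by meas.
- by move=> z; rewrite addr_ge0.
rewrite -(@integralRD _ _ _ mu2 _ f4 _ m4 _ p4); last 2 first.
- by meas.
- by move=> z; rewrite !addr_ge0.
rewrite -(@integralRD _ _ _ mu2 g1 g2 n1 n2 q1 q2).
by apply: eq_integral => z _; rewrite /f1 /f2 /f3 /f4 voronoi_decomposition.
Qed.

End planar.

(** * The inequality between sectors *)

Section slope_ineq.
Context {R : realType}.
Notation T := (measurableTypeR R).
Notation mu := (@lebesgue_measure R).

Lemma oneD_sqr_gt0 (s : R) : 0 < 1 + s ^+ 2.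
Proof. by rewrite ltr_pwDl ?sqr_ge0. Qed.

Lemma sector_density_ge0 (h s : R) : 0 <= sector_density h s.
Proof.
by rewrite divr_ge0 ?expR_ge0// mulr_ge0// ltW// oneD_sqr_gt0.
Qed.

Lemma continuous_sector_density (h : R) : continuous (sector_density h).
Proof.
apply: derivable_continuous => s; rewrite /sector_density.
apply: derivableM; first exact: ex_derive.
apply: derivableV; last exact: ex_derive.
by rewrite mulf_neq0// gt_eqF// oneD_sqr_gt0.
Qed.

(** With s = tan x this is cot(2 x); it sends b / a to (a^2 - b^2) / (2 a b) and 1 to 0. *)
Let F (s : R) : R := (s^-1 - s) / 2.
Let dF (s : R) : R := - ((s ^+ 2)^-1 + 1) / 2.

Let derive_F (s : R) : s != 0 -> is_derive s 1 F (dF s).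
Proof.
move=> s0; rewrite /F.
have sV := is_deriveV s0 (is_derive_id s (1 : R)).
apply: is_derive_eq; rewrite /GRing.scale /= /dF.
by field.
Qed.

Lemma oneDsqr_F (s : R) : s != 0 ->
  1 + F s ^+ 2 = (1 + s ^+ 2) ^+ 2 / (4 * s ^+ 2).
Proof. by move=> s0; rewrite /F; field. Qed.

Let continuous_dF (s : R) : s != 0 -> {for s, continuous dF}.
Proof.
move=> s0; rewrite /dF.
apply/differentiable_continuous/derivable1_diffP.
apply: derivableM; last exact: ex_derive.
apply: derivableN; apply: derivableD; last exact: ex_derive.
apply: derivableV; last exact: ex_derive.
by rewrite expf_neq0.
Qed.

Let derive1_F (s : R) : s != 0 -> (derive1 F) s = dF s.
Proof. by move=> s0; rewrite derive1E; have dFs := derive_F s s0; exact: derive_val. Qed.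

Let continuous_F (s : R) : s != 0 -> {for s, continuous F}.
Proof.
move=> s0; apply/differentiable_continuous/derivable1_diffP.
by have dFs := derive_F s s0; exact: ex_derive.
Qed.

Let near_derive1_F (s : R) : s != 0 -> \forall x \near s, (derive1 F) x = dF x.
Proof.
move=> s0; near=> x; apply: derive1_F; near: x.
exact: (open_neq s0).
Unshelve. all: by end_near. Qed.

Let continuous_derive1_F (s : R) : s != 0 -> {for s, continuous (derive1 F)}.
Proof.
move=> s0; rewrite /prop_for /continuous_at derive1_F//.
apply: (cvg_trans _ (continuous_dF s s0)).
apply: near_eq_cvg.
near=> x; apply: esym; near: x. exact: near_derive1_F.
Unshelve. all: by end_near. Qed.

(** Substitution x = F(s) with [F] decreasing: the Jacobian (1 + s^2) / (2 s^2) combines with 1 +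
    F(s)^2 to leave the factor 1 / (1 + s^2). *)
Lemma integral_sector_subst (b t : R) : 0 < t -> t <= 1 ->
  (\int[mu]_(x in `[0%R, F t]) (sector_density b x)%:E =
   \int[mu]_(s in `[t, 1%R])
     (expR (- ((1 + s ^+ 2) ^+ 2 / (4 * s ^+ 2) * b ^+ 2)) / (1 + s ^+ 2))%:E)%E.
Proof.
move=> t0 t1.
have F1 : F 1 = 0 by rewrite /F invr1 subrr mul0r.
have nz s : t <= s -> s != 0 by move=> ts; rewrite gt_eqF// (lt_le_trans t0).
rewrite -F1 integration_by_substitution_decreasing//.
- apply: eq_integral => s; rewrite inE /= in_itv /= => /andP[ts _].
  rewrite !fctE derive1_F ?nz//; congr EFin.
  rewrite /sector_density oneDsqr_F ?nz// /dF; field.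
  by rewrite (nz s ts) andbT gt_eqF// oneD_sqr_gt0.
- move=> x y; rewrite !in_itv /= => /andP[tx _] /andP[ty _] xy.
  rewrite /F ltr_pM2r// ltrD// ?ltrN2// ltf_pV2 ?posrE//; exact: lt_le_trans t0 _.
- move=> s; rewrite in_itv /= => /andP[ts _]; apply: continuous_derive1_F.
  by rewrite nz// ltW.
- apply: cvgP; apply: cvg_at_right_filter; apply: continuous_derive1_F; exact: nz.
- apply: cvgP; apply: cvg_at_left_filter; apply: continuous_derive1_F; exact: nz.
- split.
  + move=> s; rewrite in_itv /= => /andP[ts _].
    by have dFs := derive_F s (nz s (ltW ts)); exact: ex_derive.
  + apply: cvg_at_right_filter; apply: continuous_F; exact: nz.
  + apply: cvg_at_left_filter; apply: continuous_F; exact: nz.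
- by apply: continuous_subspaceT; exact: continuous_sector_density.
Qed.

Lemma measurable_sector_density (h : R) :
  measurable_fun [set: T] (sector_density h).
Proof. exact: (continuous_measurable_fun (continuous_sector_density h)). Qed.

Let measurable_subst_density (b t : R) : 0 < t ->
  measurable_fun (`[t, 1%R] : set R) (fun s : R =>
    expR (- ((1 + s ^+ 2) ^+ 2 / (4 * s ^+ 2) * b ^+ 2)) / (1 + s ^+ 2)).
Proof.
move=> t0.
have m1 : measurable_fun (`[t, 1%R] : set R) (fun s : R => (1 + s ^+ 2)^-1).
  apply: measurable_funTS; apply: continuous_measurable_fun.
  apply: derivable_continuous => s; apply: derivableV; last exact: ex_derive.
  by rewrite gt_eqF// oneD_sqr_gt0.
(* The inverse of s^2 is continuous only off 0, hence the detour through the open half-line. *)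
have m2 : measurable_fun (`[t, 1%R] : set R) (fun s : R => (4 * s ^+ 2)^-1).
  apply: (@measurable_funS _ _ _ _ (`]0, +oo[ : set R)).
  - exact: measurable_itv.
  - by move=> s /=; rewrite !in_itv /= => /andP[ts _]; rewrite (lt_le_trans t0).
  apply: open_continuous_measurable_fun; first exact: interval_open.
  move=> s; rewrite inE /= in_itv /= andbT => s0.
  apply/differentiable_continuous/derivable1_diffP.
  apply: derivableV; last exact: ex_derive.
  by rewrite mulf_neq0// expf_neq0// gt_eqF.
have mid : measurable_fun (`[t, 1%R] : set R) (fun s : R => s).
  exact: measurable_id.
by meas; exact: mid.
Qed.

(** The denominators agree, and comparing the exponents amounts to the last hypothesis once a factor
    1 + s^2 is cancelled. For 4 h^2 = a^2 + b^2 it reads b^2 <= a^2 s^2. *)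
Lemma sector_le_subst (h b t s : R) : 0 < t -> t <= s ->
  b ^+ 2 * (1 + s ^+ 2) <= 4 * h ^+ 2 * s ^+ 2 ->
  2 * sector_density h s <=
  expR (- ((1 + s ^+ 2) ^+ 2 / (4 * s ^+ 2) * b ^+ 2)) / (1 + s ^+ 2).
Proof.
move=> t0 ts hb; have s0 : 0 < s by exact: lt_le_trans ts.
have D0 := oneD_sqr_gt0 s.
rewrite /sector_density.
have -> x : 2 * (x / (2 * (1 + s ^+ 2))) = x / (1 + s ^+ 2).
  by field; rewrite gt_eqF.
rewrite ler_wpM2r ?invr_ge0 ?(ltW D0)// ler_expR lerN2 mulrAC ler_pdivrMr; last first.
  by rewrite mulr_gt0// exprn_gt0.
rewrite expr2 -!mulrA ler_pM2l//; lra.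
Qed.

Lemma sector_inequality (a b : R) : 0 <= b -> b <= a -> 0 < a ->
  (2%:E * \int[mu]_s (ind ((b < a * s) && (s <= 1)) *
       sector_density (Num.sqrt (a ^+ 2 + b ^+ 2) / 2) s)%:E <=
   \int[mu]_s (ind ((0 <= s) && (2 * a * b * s < a ^+ 2 - b ^+ 2)) *
     sector_density b s)%:E)%E.
Proof.
move=> b0 ba a0; set h := Num.sqrt _ / 2.
have h2 : 4 * h ^+ 2 = a ^+ 2 + b ^+ 2.
  by rewrite /h expr_div_n sqr_sqrtr ?addr_ge0 ?sqr_ge0//; field.
have md := measurable_sector_density.
have d0 := sector_density_ge0.
rewrite -integralRZl; last 3 first.
- by [].
- have mdx := md h; by meas.
- by move=> s; rewrite mulr_ge0.
have [b00|b00] := eqVneq b 0.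
  rewrite b00 in h2 *.
  have oneE (s : R) : (oneDsqr s)^-1 = 2 * sector_density 0 s.
    rewrite /sector_density expr0n mulr0 oppr0 expR0 /oneDsqr.
    by field; rewrite gt_eqF// oneD_sqr_gt0.
  have one0 (s : R) : 0 <= (oneDsqr s)^-1.
    by rewrite oneE mulr_ge0.
  have mone : measurable_fun [set: T] (fun s : R => (oneDsqr s)^-1).
    exact: (continuous_measurable_fun continuous_oneDsqrV).
  (* The left-hand side is at most arctan 1, the exponential factor being at most 1. *)
  apply: (@le_trans _ _ (pi / 4)%:E).
    apply: (@le_trans _ _ (\int[mu]_(s in `[0%R, 1%R]) (oneDsqr s)^-1%:E)%E).
      rewrite integral_boolR; under [leRHS]eq_integral do rewrite -EFinM.
      apply: le_integralR.
      - by have mdx := md h; meas.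
      - by meas.
      - by move=> s; apply: mulr_ge0 => //; apply: mulr_ge0.
      - move=> s; rewrite mulrCA in_itv /= oneE.
        have [as0|as0] := leP 0 s; last first.
          rewrite (_ : (0 < a * s) = false) ?mul0r//.
          by apply/negbTE; rewrite -leNgt pmulr_rle0// ltW.
        case: (s <= 1); rewrite ?andbF ?andbT ?mul0r//= mul1r.
        apply: (@le_trans _ _ (2 * sector_density h s)).
          by case: (0 < a * s); rewrite ?mul1r ?mul0r// mulr_ge0.
        rewrite ler_wpM2l// ler_wpM2r ?invr_ge0 ?mulr_ge0 ?(ltW (oneD_sqr_gt0 s))//.
        rewrite ler_expR lerN2 expr0n mulr0 mulr_ge0 ?sqr_ge0//.
        exact/ltW/oneD_sqr_gt0.
    rewrite (@continuous_FTC2 _ _ (@atan R))//.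
    + by rewrite atan0 sube0 atan1.
    + by apply: continuous_in_subspaceT => x ?; exact: continuous_oneDsqrV.
    + split.
      * by move=> x _; exact: derivable_atan.
      * by apply: cvg_at_right_filter; exact: continuous_atan.
      * by apply: cvg_at_left_filter; exact: continuous_atan.
    + by move=> x x01; rewrite derive1_atan// mul1r.
  (* For b = 0 the density on the right is half of 1 / (1 + s^2), taken over the whole half-line. *)
  apply: (@le_trans _ _ (2^-1%:E * \int[mu]_(s in `[0%R, +oo[) (oneDsqr s)^-1%:E)%E).
    rewrite integral0y_oneDsqr -EFinM lee_fin.
    by have -> : 2^-1 * (pi / 2) = pi / 4 :> R by field.
  rewrite integral_boolR; under eq_integral do rewrite -EFinM.
  rewrite -integralRZl; last 3 first.
  - by rewrite invr_ge0.
  - by meas.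
  - by move=> s; rewrite mulr_ge0.
  apply: le_integralR.
  - by meas.
  - by have mdx := md 0; meas.
  - by move=> s; rewrite mulr_ge0 ?invr_ge0// mulr_ge0.
  - move=> s; rewrite in_itv /= andbT mulr0 mul0r expr0n subr0 exprn_gt0// andbT.
    by rewrite oneE mulrCA mulKf.
have bp : 0 < b by rewrite lt0r b00.
pose t := b / a.
have t0 : 0 < t by rewrite divr_gt0.
have t1 : t <= 1 by rewrite ler_pdivrMr// mul1r.
have tE s : (b < a * s) = (t < s) by rewrite /t ltr_pdivrMr// mulrC.
apply: (@le_trans _ _ (\int[mu]_(s in `[t, 1%R]) (2 * sector_density h s)%:E)%E).
  rewrite integral_boolR; under [leRHS]eq_integral do rewrite -EFinM.
  apply: le_integralR.
  - by have mdx := md h; meas.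
  - by have mdx := md h; meas.
  - by move=> s; apply: mulr_ge0 => //; apply: mulr_ge0.
  - move=> s; rewrite mulrCA; apply: ler_wpM2r; first by rewrite mulr_ge0.
    rewrite in_itv /= tE.
    by rewrite ler_nat; case: (ltP t s) => // /ltW ->.
apply: (@le_trans _ _ (\int[mu]_(s in `[t, 1%R])
  (expR (- ((1 + s ^+ 2) ^+ 2 / (4 * s ^+ 2) * b ^+ 2)) / (1 + s ^+ 2))%:E)%E).
  apply: ge0_le_integral.
  - exact: measurable_itv.
  - by move=> s _; rewrite lee_fin mulr_ge0.
  - by apply: measurable_funTS; have mdx := md h; meas.
  - by apply/measurable_EFinP; exact: measurable_subst_density.
  - move=> s /=; rewrite in_itv /= => /andP[ts _]; rewrite lee_fin.
    apply: (sector_le_subst _ _ t) => //; rewrite h2.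
    have bs : b <= a * s by rewrite mulrC -ler_pdivrMr.
    have : b ^+ 2 <= (a * s) ^+ 2 by rewrite ler_sqr ?nnegrE// (le_trans b0).
    lra.
rewrite -integral_sector_subst// -integral_itv_bndo_bndc; last first.
  by apply: measurable_funTS; have mdx := md b; meas.
rewrite integral_boolR; under eq_integral do rewrite -EFinM.
apply: le_integralR.
- by have mdx := md b; meas.
- by have mdx := md b; meas.
- by move=> s; rewrite mulr_ge0.
move=> s; apply: ler_wpM2r; first by [].
rewrite in_itv /= ler_nat.
(* The upper limit [F t] is exactly the slope bound of the right-hand side. *)
rewrite (_ : F t = (a ^+ 2 - b ^+ 2) / (2 * a * b)); last first.
  by rewrite /F /t; field; rewrite !gt_eqF.
by rewrite ltr_pdivlMr ?mulr_gt0// [s * _]mulrC.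
Qed.

End slope_ineq.

(** * Comparison with the square *)

Section comparison.
Context {R : realType}.
Notation T := (measurableTypeR R).
Notation mu := (@lebesgue_measure R).
Notation mu2 := (mu \x mu)%E.
Notation g := (Num.sqrt (@pi R)).

(** Finiteness of [C] makes all terms finite, and then Q = C - 2 M - W <= C - 2 M - 2 D = Q'. *)
Lemma lee_cancel (Q Q' M D W C : \bar R) :
  (0 <= Q -> 0 <= Q' -> 0 <= M -> 0 <= D -> 0 <= W -> C < +oo ->
   Q + M + M + W = C -> Q' + (M + D) + (M + D) = C -> 2%:E * D <= W ->
   Q <= Q')%E.
Proof.
case: C => [c| |] //; last first.
  move=> Q0 _ M0 _ W0 _ E.
  by have := adde_ge0 (adde_ge0 (adde_ge0 Q0 M0) M0) W0; rewrite E.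
case: Q => [q| |] //=; case: Q' => [q'| |] //=; case: M => [m| |] //=;
  case: D => [d| |] //=; case: W => [w| |] //=.
rewrite -!EFinD -EFinM !lee_fin => _ _ _ _ _ _ [E] [E']; lra.
Qed.

(** The integrand of [P] with the common factor exp(-|x|^2) taken out and the two signs absorbed in
    absolute values; [z] stands for the pair of inner products of x with v1 and v2. *)
Definition gauss_pair (a b : R) (z : R * R) : R :=
  Num.max (expR (2 * `|z.1| - a ^+ 2)) (expR (2 * `|z.2| - b ^+ 2)).

Definition quadrant_mass (a b : R) : \bar R :=
  (\int[mu2]_z (ind ((0 <= z.1) && (0 <= z.2)) *
    Num.max (expR (- (z.1 - a) ^+ 2 - z.2 ^+ 2))
            (expR (- z.1 ^+ 2 - (z.2 - b) ^+ 2)))%:E)%E.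

Lemma quadrant_massC a b : quadrant_mass a b = quadrant_mass b a.
Proof.
rewrite /quadrant_mass -integral_swap; last 2 first.
- by meas.
- by move=> z; rewrite lee_fin mulr_ge0// le_max expR_ge0.
apply: eq_integral => z _ /=; rewrite andbC maxC.
by congr (_ * Num.max (expR _) (expR _))%:E; ring.
Qed.

(** Only the absolute values of [al] and [ga] matter, and evenness in both coordinates reduces the
    integral to one quadrant. *)
Lemma gauss_planar_pairE a b al ga : 0 <= a -> 0 <= b ->
  al ^+ 2 = a ^+ 2 -> ga ^+ 2 = b ^+ 2 ->
  (gauss_planar (gauss_pair a b) al 0 ga = 4%:E * quadrant_mass a b)%E.
Proof.
move=> a0 b0 al2 ga2.
have alE : `|al| = a by apply/eqP; rewrite -(@eqrXn2 _ 2)// real_normK ?num_real// al2.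
have gaE : `|ga| = b by apply/eqP; rewrite -(@eqrXn2 _ 2)// real_normK ?num_real// ga2.
rewrite /gauss_planar /gauss_pair integral_quadrant; last 4 first.
- by meas.
- by move=> z; rewrite mulr_ge0 ?expR_ge0// le_max expR_ge0.
- by move=> z /=; rewrite sqrrN mulrN normrN !mul0r.
- by move=> z /=; rewrite sqrrN mulrN mul0r !add0r normrN.
congr (_ * _)%E; apply: eq_integral => -[x y] _ /=; congr EFin.
have [x0|x0] := leP 0 x; last by rewrite !mul0r.
have [y0|y0] := leP 0 y; last by rewrite !mul0r.
rewrite !mul1r mul0r add0r !normrM alE gaE !ger0_norm// maxr_pMr ?expR_ge0//.
by rewrite -!expRD; congr (Num.max (expR _) (expR _)); ring.
Qed.

(** [planar_identity] for (a, b) and for (d, d) with 2 d^2 = a^2 + b^2 has the same right-hand side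
    and the same [h], so only the lost sectors have to be compared. *)
Lemma quadrant_mass_le (a b : R) : 0 <= b -> b <= a -> 0 < a ->
  (quadrant_mass a b <= quadrant_mass (Num.sqrt ((a ^+ 2 + b ^+ 2) / 2))
                                      (Num.sqrt ((a ^+ 2 + b ^+ 2) / 2)))%E.
Proof.
move=> b0 ba a0; set d := Num.sqrt _.
have c0 : 0 < a ^+ 2 + b ^+ 2 by rewrite ltr_wpDr ?sqr_ge0// exprn_gt0.
have d0 : 0 < d by rewrite sqrtr_gt0 divr_gt0.
have dE : d ^+ 2 + d ^+ 2 = a ^+ 2 + b ^+ 2.
  by rewrite sqr_sqrtr ?divr_ge0// ?ltW//; field.
have := planar_identity a b b0 ba a0.
have := planar_identity d d (ltW d0) (lexx _) d0.
rewrite dE subrr -!/(quadrant_mass _ _).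
set h := _ / 2.
have md := measurable_sector_density.
have sd0 := @sector_density_ge0 R.
(* For the square the slope bound is 0 and the third sector is empty. *)
have W0 : (\int[mu]_s (ind ((0 <= s) && (2 * d * d * s < 0)) *
    sector_density d s)%:E = 0)%E.
  apply: integral0_eq => s _; rewrite (_ : _ && _ = false) ?mul0r//.
  by apply/negbTE/negP => /andP[s0]; rewrite ltNge !mulr_ge0// ltW.
rewrite W0 adde0.
(* The slopes s <= 1 of the square are those of the rhombus, s <= b / a, and those in between. *)
have -> : (\int[mu]_s (ind (d * s <= d) * sector_density h s)%:E =
   \int[mu]_s (ind (a * s <= b) * sector_density h s)%:E +
   \int[mu]_s (ind ((b < a * s) && (s <= 1)) * sector_density h s)%:E)%E.
  rewrite -integralRD; last 4 first.
  - by have mdx := md _ h; meas.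
  - by have mdx := md _ h; meas.
  - by move=> s; rewrite mulr_ge0.
  - by move=> s; rewrite mulr_ge0.
  apply: eq_integral => s _; rewrite -mulrDl; congr (_ * _)%:E.
  rewrite -{2}[d]mulr1 ler_pM2l//.
  have [asb|asb] := leP (a * s) b; last by rewrite add0r.
  rewrite addr0 (_ : s <= 1 = true)//.
  by rewrite -(ler_pM2l a0) mulr1 (le_trans asb).
set C := (X in _ = X).
move=> E' E.
apply: (lee_cancel _ _ _ _ _ C _ _ _ _ _ _ E E').
- by apply: integral_ge0 => z _; rewrite lee_fin mulr_ge0// le_max expR_ge0.
- by apply: integral_ge0 => z _; rewrite lee_fin mulr_ge0// le_max expR_ge0.
- by apply: integral_ge0 => z _; rewrite lee_fin mulr_ge0.
- by apply: integral_ge0 => z _; rewrite lee_fin mulr_ge0.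
- by apply: integral_ge0 => z _; rewrite lee_fin mulr_ge0.
- have bnd (p : R * R -> bool) : measurable_fun setT p ->
    (\int[mu2]_z ((p z)%:R * expR (- z.1 ^+ 2 - z.2 ^+ 2))%:E <= (g * g)%:E)%E.
    move=> mp.
    rewrite EFinM -(@integralT_gauss R) -(integral2M gauss_fun gauss_fun); last 4 first.
    + by rewrite /gauss_fun; meas.
    + by rewrite /gauss_fun; meas.
    + by move=> x; exact: expR_ge0.
    + by move=> x; exact: expR_ge0.
    apply: le_integralR.
    + by meas.
    + by rewrite /gauss_fun; meas.
    + by move=> z; rewrite mulr_ge0 ?expR_ge0.
    + move=> z; rewrite /gauss_fun -expRD; case: (p z); rewrite ?mul1r ?mul0r.
        by [].
      by rewrite expR_ge0.
  apply: le_lt_trans (leeD (bnd (fun z => 0 <= z.2) _) (bnd (fun z => 0 <= z.1) _)) _.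
  + by meas.
  + by meas.
  + by rewrite -EFinD ltry.
- exact: sector_inequality.
Qed.

End comparison.

(** * Passage from [P] to the plane, and conclusion *)

Section reduction.
Context {R : realType}.
Notation mu := (@lebesgue_measure R).
Notation mu2 := (mu \x mu)%E.
Notation g := (Num.sqrt (@pi R)).

Lemma dotr_ge0 n (v : 'rV[R]_n) : 0 <= dotr v v.
Proof. by apply: sumr_ge0 => i _; rewrite -expr2 sqr_ge0. Qed.

Lemma enorm_sqr n (v : 'rV[R]_n) : enorm v ^+ 2 = dotr v v.
Proof. by rewrite sqr_sqrtr// dotr_ge0. Qed.

Lemma enorm_ge0 n (v : 'rV[R]_n) : 0 <= enorm v.
Proof. exact: sqrtr_ge0. Qed.

Lemma dotrNr n (x v : 'rV[R]_n) : dotr x (- v) = - dotr x v.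
Proof. by rewrite /dotr -sumrN; apply: eq_bigr => i _; rewrite mxE mulrN. Qed.

Lemma enorm_subr_sqr n (x v : 'rV[R]_n) :
  enorm (x - v) ^+ 2 = dotr x x - 2 * dotr x v + enorm v ^+ 2.
Proof.
rewrite !enorm_sqr /dotr mulr_sumr -sumrB -big_split; apply: eq_bigr => i _ /=.
by rewrite !mxE; ring.
Qed.

Lemma enormN n (v : 'rV[R]_n) : enorm (- v) = enorm v.
Proof.
by rewrite /enorm; congr Num.sqrt; apply: eq_bigr => i _; rewrite !mxE mulrNN.
Qed.

Lemma max_expR_opp (p k : R) :
  Num.max (expR (2 * p - k)) (expR (- (2 * p) - k)) = expR (2 * `|p| - k).
Proof.
have [p0|/ltW p0] := leP 0 p.
  rewrite ger0_norm// max_l// ler_expR lerD2r; lra.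
rewrite ler0_norm// mulrN max_r// ler_expR lerD2r; lra.
Qed.

Lemma P_pairE n (v1 v2 : 'rV[R]_n) :
  P [:: v1; - v1; v2; - v2] =
  (\int[lebesgue_rV R n]_x (expR (- dotr x x) *
     gauss_pair (enorm v1) (enorm v2) (dotr x v1, dotr x v2))%:E)%E.
Proof.
apply: eq_integral => x _; congr EFin.
rewrite !big_cons big_nil !enorm_subr_sqr !enormN !dotrNr.
have e u s : expR (- (dotr x x - 2 * u + s)) = expR (- dotr x x) * expR (2 * u - s).
  by rewrite -expRD; congr expR; ring.
(* The base value 0 of the maximum lies below an exponential and drops out. *)
rewrite !e [X in Num.max _ (Num.max _ (Num.max _ X))]max_l; last first.
  by rewrite mulr_ge0 ?expR_ge0.
rewrite maxA !mulrN /gauss_pair /= -!max_expR_opp !maxr_pMr ?expR_ge0//.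
Qed.

Lemma measurable_gauss_pair (a b : R) : measurable_fun setT (gauss_pair a b).
Proof. by rewrite /gauss_pair; meas. Qed.

Lemma gauss_pair_ge0 (a b : R) z : 0 <= gauss_pair a b z.
Proof. by rewrite le_max expR_ge0. Qed.

Lemma gauss_abs_mono (k : R) : even_mono (fun x => expR (2 * `|x| - k)).
Proof. by move=> x y xy; rewrite ler_expR lerD2r ler_pM2l. Qed.

(** Reduction to the plane followed by Sidak's inequality, which replaces (al, be, ga) by (al, 0, r)
    with r^2 = |v2|^2 and so keeps both lengths. *)
Lemma P_le_quadrant_mass n (v1 v2 : 'rV[R]_n) :
  ((g ^+ 2)%:E * P [:: v1; (- v1)%R; v2; (- v2)%R] <=
   (g ^+ n)%:E * (4%:E * quadrant_mass (enorm v1) (enorm v2)))%E.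
Proof.
have [al [be [ga [alE _ gaE red]]]] := @gauss_reduction R n v1 v2.
rewrite P_pairE red; [|exact: measurable_gauss_pair|exact: gauss_pair_ge0].
apply: lee_wpmul2l; first by rewrite lee_fin exprn_ge0// ltW// sqrt_pi_gt0.
have [||||||r rE Jle] := gauss_planar_le_orthogonal
  (fun x => expR (2 * `|x| - enorm v1 ^+ 2))
  (fun x => expR (2 * `|x| - enorm v2 ^+ 2)) al be ga.
- by meas.
- by move=> x; exact: expR_ge0.
- exact: gauss_abs_mono.
- by meas.
- by move=> x; exact: expR_ge0.
- exact: gauss_abs_mono.
apply: (le_trans Jle).
rewrite -(gauss_planar_pairE _ _ al r); first exact: lexx.
- exact: enorm_ge0.
- exact: enorm_ge0.
- by rewrite enorm_sqr.
- by rewrite enorm_sqr rE.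
Qed.

(** The reduction itself gives be = 0 here, since al be = 0 with [al] nonzero; thus equality
    holds. *)
Lemma P_orthogonalE n (w1 w2 : 'rV[R]_n) : enorm w1 != 0 -> dotr w1 w2 = 0 ->
  ((g ^+ 2)%:E * P [:: w1; (- w1)%R; w2; (- w2)%R] =
   (g ^+ n)%:E * (4%:E * quadrant_mass (enorm w1) (enorm w2)))%E.
Proof.
move=> w10 w12.
have [al [be [ga [alE beE gaE red]]]] := @gauss_reduction R n w1 w2.
have al0 : al != 0 by rewrite -sqrf_eq0 alE -enorm_sqr sqrf_eq0.
have be0 : be = 0 by apply: (mulfI al0); rewrite beE w12 mulr0.
rewrite be0 expr0n add0r in gaE red.
rewrite P_pairE red; [|exact: measurable_gauss_pair|exact: gauss_pair_ge0].
rewrite (gauss_planar_pairE (enorm w1) (enorm w2)); first by [].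
- exact: enorm_ge0.
- exact: enorm_ge0.
- by rewrite enorm_sqr.
- by rewrite enorm_sqr gaE.
Qed.

End reduction.

Theorem theorem4p1 (R : realType) (n : nat) (hn : (2 <= n)%N)
    (c : R) (hc : 0 < c) (v1 v2 w1 w2 : 'rV[R]_n)
    (hv : enorm v1 ^+ 2 + enorm v2 ^+ 2 = c ^+ 2)
    (hw : enorm w1 ^+ 2 + enorm w2 ^+ 2 = c ^+ 2)
    (hw_len : enorm w1 = enorm w2)
    (hw_orth : dotr w1 w2 = 0) :
  (P [:: v1; (- v1)%R; v2; (- v2)%R] <= P [:: w1; (- w1)%R; w2; (- w2)%R])%E.
Proof.
have c2 : 0 < c ^+ 2 by rewrite exprn_gt0.
(* The common length c / sqrt(2), in the form produced by [quadrant_mass_le]. *)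
have wE : enorm w1 = Num.sqrt (c ^+ 2 / 2).
  rewrite -hw -hw_len (_ : _ / 2 = enorm w1 ^+ 2); last by field.
  by rewrite sqrtr_sqr ger0_norm// enorm_ge0.
have w10 : enorm w1 != 0 by rewrite wE gt_eqF// sqrtr_gt0 divr_gt0.
apply: (lee_pmul2l_fin (Num.sqrt pi ^+ 2)); first by rewrite exprn_gt0// sqrt_pi_gt0.
rewrite (P_orthogonalE _ _ _ w10 hw_orth) -hw_len wE.
apply: le_trans (P_le_quadrant_mass _ _ _) _.
apply: lee_wpmul2l; first by rewrite lee_fin exprn_ge0// ltW// sqrt_pi_gt0.
apply: lee_wpmul2l; first by rewrite lee_fin.
wlog v21 : v1 v2 hv / enorm v2 <= enorm v1 => [hwlog|].
  have [v21|/ltW v12] := leP (enorm v2) (enorm v1); first exact: hwlog.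
  by rewrite quadrant_massC; apply: hwlog => //; rewrite addrC.
rewrite -hv; apply: quadrant_mass_le => //; first exact: enorm_ge0.
(* The longer vector is nonzero because c > 0. *)
rewrite lt0r enorm_ge0 andbT; apply/negP => /eqP v10.
have v20 : enorm v2 = 0 by apply: le_anti; rewrite enorm_ge0 andbT -v10.
by move: c2; rewrite -hv v10 v20 expr0n addr0 ltxx.
Qed.
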